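(* Let $G$ be a discrete group and let $X \subset \mathrm{B}(G)$ be a closed subspace. The following conditions are equivalent: (i) $X$ is an $L$-space; (ii) $X$ is $G$-bi-invariant, i.e. $\mathbb{C}[G]\cdot X \subset X$ and $X\cdot \mathbb{C}[G] \subset X$; (iii) there exists a central projection $z \in W^{\ast}(G)$ such that $X = z\, \mathrm{B}(G)$.
   Context: For a discrete group $G$, $\mathrm{B}(G)$ is the Fourier--Stieltjes algebra, identified with the dual of the full group $C^*$-algebra $C^*(G)$ via $\langle f,x\rangle=\sum_g f(g)x(g)$, $x\in\mathbb{C}[G]$. $W^{\ast}(G):=C^*(G)^{**}=\mathrm{B}(G)^*$ is the universal enveloping von Neumann algebra; $\mathrm{B}(G)$ is its predual. $W^*(G)$ acts on $\mathrm{B}(G)$ from both sides by $(x\varphi)(y):=\varphi(yx)$ and $(\varphi x)(y):=\varphi(xy)$ for $x,y\in W^*(G)$, $\varphi\in\mathrm{B}(G)$; $\mathbb{C}[G]\subset C^*(G)\subset W^*(G)$ acts by restriction (elements of $G$ act by translations). For $\varphi\in\mathrm{B}(G)$, the central support $\mathrm{zs}(\varphi)$ is the smallest central projection $z\in W^*(G)$ such that $\varphi$ vanishes on $(1-z)W^*(G)$; $\varphi\ll\psi$ means $\mathrm{zs}(\varphi)\leq\mathrm{zs}(\psi)$. A closed subspace $X\subset\mathrm{B}(G)$ is an $L$-space if $f\in X$ and $g\ll f$ imply $g\in X$. *)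

(* Defs.v *)
From HB Require Import structures.
From mathcomp Require Import all_boot all_order all_algebra.
From mathcomp Require Import finmap sesquilinear complex.
(* The notations of [monalg] clash with those of MathComp-Analysis. *)
From mathcomp.multinomials Require Import -(notations) monalg.
From mathcomp Require Import boolp classical_sets functions reals.
From mathcomp Require Import topology normedtype.
From mathcomp Require Import ring lra.

Set Implicit Arguments.
Unset Strict Implicit.
Unset Printing Implicit Defensive.

Import Order.TTheory GRing.Theory Num.Theory.
Import numFieldNormedType.Exports.

Local Open Scope classical_set_scope.
Local Open Scope ring_scope.

Local Notation "{ 'malg' A [ K ] }" := (@malg K A)
  (at level 0, K, A at level 2, format "{ 'malg'  A [ K ] }") : type_scope.
Local Notation "x @_ g" := (mcoeff g x)
  (at level 3, g at level 2, left associativity, format "x @_ g") : ring_scope.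
Local Notation delta c g := (mkmalgU g c).
Local Notation "r %:C" := (real_complex _ r) : ring_scope.

(* The norm `|v| of a normedModType over R[i] is an element of R[i]. *)
Definition rnorm (R : realType) (V : normedModType R[i]) (v : V) : R :=
  complex.Re `|v|.

Section rnorm.
Context {R : realType} {V : normedModType R[i]}.
Implicit Types v w : V.

Lemma rnormE v : (rnorm v)%:C = `|v|.
Proof. by rewrite /rnorm RRe_real// ger0_real. Qed.

Lemma rnorm_ge0 v : 0 <= rnorm v.
Proof. by rewrite -ler0c rnormE. Qed.

Lemma rnorm0 : rnorm (0 : V) = 0.
Proof. by rewrite /rnorm normr0. Qed.

Lemma rnormD v w : rnorm (v + w) <= rnorm v + rnorm w.
Proof. by rewrite -lecR rmorphD/= !rnormE ler_normD. Qed.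

Lemma rnormZ c v : rnorm (c *: v) = rnorm (c : R[i]^o) * rnorm v.
Proof. by apply: complexI; rewrite rmorphM/= !rnormE normrZ. Qed.

Lemma rnorm_eq0 v : rnorm v = 0 -> v = 0.
Proof. by move=> v0; apply/normr0_eq0; rewrite -rnormE v0. Qed.

Lemma rnorm_sum (I : Type) (s : seq I) (F : I -> V) :
  rnorm (\sum_(i <- s) F i) <= \sum_(i <- s) rnorm (F i).
Proof.
elim/big_rec2: _ => [|i y x _ h]; first by rewrite rnorm0.
by rewrite (le_trans (rnormD _ _))// lerD2l.
Qed.

End rnorm.

(* inf {M >= 0 | forall i, a i <= M * b i}: with [a i := `|T i|] and
   [b i := `|i|], the operator norm of T. *)
Section best_constant.
Context {R : realType} {I : Type}.
Variables a b : I -> R.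

Definition best_constant : R := inf [set M | 0 <= M /\ forall i, a i <= M * b i].

Lemma best_constant_ge0 : 0 <= best_constant.
Proof.
rewrite /best_constant; set S := [set _ | _].
have [[x Sx]|S0] := pselect (S !=set0).
  by apply: lb_le_inf; [exists x|move=> y []].
suff -> : S = set0 by rewrite inf0.
by rewrite -subset0 => x Sx; apply: S0; exists x.
Qed.

Lemma best_constant_le M : 0 <= M -> (forall i, a i <= M * b i) ->
  best_constant <= M.
Proof. by move=> M0 h; apply: ge_inf => //; exists 0 => y []. Qed.

Lemma best_constantP M i : 0 <= M -> (forall i, 0 <= b i) ->
  (forall i, a i <= M * b i) -> a i <= best_constant * b i.
Proof.
move=> M0 b0 h; have := b0 i; rewrite le_eqVlt => /orP[/eqP bi0|bi_gt0].
  by have := h i; rewrite -bi0 !mulr0.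
rewrite -ler_pdivrMr//; apply: lb_le_inf; first by exists M.
by move=> y [y0 hy]; rewrite ler_pdivrMr.
Qed.

End best_constant.

Section group_algebra.
Context {R : realType} {G : groupType}.
Local Notation C := R[i].
Local Notation CG := {malg C[G]}.
Implicit Types (x y : CG) (g h : G).

Definition cg_mul x y : CG :=
  \sum_(g <- msupp x) \sum_(h <- msupp y) delta (x@_g * y@_h) (g * h)%g.

Definition cg_star x : CG := \sum_(g <- msupp x) delta (x@_g)^* (g^-1)%g.

Definition cg_ext (V : lmodType C) (L : G -> V) x : V :=
  \sum_(g <- msupp x) x@_g *: L g.

Lemma cg_extw (V : lmodType C) (L : G -> V) x (d : {fset G}) :
  fsubset (msupp x) d -> cg_ext L x = \sum_(g <- d) x@_g *: L g.
Proof.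
move=> sd; rewrite /cg_ext (big_fset_incl _ sd)//= => g _ gx.
by rewrite (mcoeff_outdom gx) scale0r.
Qed.

Lemma cg_extD (V : lmodType C) (L : G -> V) x y :
  cg_ext L (x + y) = cg_ext L x + cg_ext L y.
Proof.
pose d := (msupp x `|` msupp y)%fset.
rewrite !(@cg_extw _ _ _ d) ?fsubsetUl ?fsubsetUr ?msuppD_le//.
by rewrite -big_split/=; apply: eq_bigr => g _; rewrite mcoeffD scalerDl.
Qed.

Lemma cg_ext0 (V : lmodType C) (L : G -> V) : cg_ext L 0 = 0.
Proof. by rewrite /cg_ext msupp0 big_seq_fset0. Qed.

Lemma cg_extU (V : lmodType C) (L : G -> V) (c : C) g :
  cg_ext L (delta c g) = c *: L g.
Proof.
rewrite (cg_extw _ (msuppU_le)) big_seq_fset1.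
by rewrite mcoeffUU.
Qed.

Lemma cg_ext_sum (V : lmodType C) (L : G -> V) (I : Type) (s : seq I)
    (F : I -> CG) : cg_ext L (\sum_(i <- s) F i) = \sum_(i <- s) cg_ext L (F i).
Proof.
by elim/big_rec2: _ => [|i a b _ <-]; rewrite ?cg_ext0 ?cg_extD.
Qed.

Lemma cg_ext_mul (V : lmodType C) (L : G -> V) x y :
  cg_ext L (cg_mul x y) = cg_ext (fun g => cg_ext (fun h => L (g * h)%g) y) x.
Proof.
rewrite cg_ext_sum; apply: eq_bigr => g _.
rewrite cg_ext_sum scaler_sumr; apply: eq_bigr => h _.
by rewrite cg_extU scalerA.
Qed.

Lemma cg_ext_star (V : lmodType C) (L : G -> V) x :
  cg_ext L (cg_star x) = \sum_(g <- msupp x) (x@_g)^* *: L (g^-1)%g.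
Proof.
by rewrite cg_ext_sum; apply: eq_bigr => g _; rewrite cg_extU.
Qed.

Definition pairing (f : G -> C) x : C := \sum_(g <- msupp x) f g * x@_g.

Lemma pairingE (f : G -> C) x : pairing f x = cg_ext (f : G -> C^o) x.
Proof. by apply: eq_bigr => g _; rewrite mulrC. Qed.

End group_algebra.

(* {dot H for Num.conj}: positive definite hermitian forms on H, linear in the
   first variable and conjugate-linear in the second one. *)
Record hilbert (R : realType) := Hilbert {
  hilbert_space :> completeNormedModType R[i] ;
  hdot : {dot hilbert_space for (Num.conj : R[i] -> R[i])} ;
  hdot_norm : forall v, hdot v v = `|v| ^+ 2
}.

Record unitary_rep (R : realType) (G : groupType) := UnitaryRep {
  rep_space :> hilbert R ;
  rep_act : G -> {linear rep_space -> rep_space} ;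
  rep_act1 : forall v, rep_act 1%g v = v ;
  rep_actM : forall g h v, rep_act (g * h)%g v = rep_act g (rep_act h v) ;
  rep_unitary : forall g v w,
    hdot rep_space (rep_act g v) (rep_act g w) = hdot rep_space v w
}.

Section cstar_norm.
Context {R : realType} {G : groupType}.
Local Notation C := R[i].
Local Notation CG := {malg C[G]}.
Implicit Types (x y : CG) (g h : G) (pi : unitary_rep R G).

(* The operator pi(x), for x in C[G]. *)
Definition rep_ext pi x (v : pi) : pi := cg_ext (fun g => rep_act pi g v) x.

Definition rep_norm pi x : R :=
  best_constant (fun v : pi => rnorm (rep_ext x v)) (fun v : pi => rnorm v).

(* The norm of the full C*-algebra C*(G), which is the completion of C[G] for
   this norm: the supremum of the operator norms over all unitary
   representations. *)
Definition cstar_norm x : R :=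
  sup [set r | exists pi : unitary_rep R G, r = rep_norm pi x].

Lemma rnorm_dot pi (v : pi) : ((rnorm v) ^+ 2)%:C = hdot pi v v.
Proof. by rewrite rmorphXn/= rnormE hdot_norm. Qed.

Lemma rep_act_norm pi g (v : pi) : rnorm (rep_act pi g v) = rnorm v.
Proof.
apply: (@pexpIrn R 2) => //; rewrite ?nnegrE ?rnorm_ge0//.
by apply: complexI; rewrite !rnorm_dot rep_unitary.
Qed.

Definition l1norm x : R := \sum_(g <- msupp x) rnorm (x@_g : C^o).

Lemma l1norm_ge0 x : 0 <= l1norm x.
Proof. by apply: sumr_ge0 => g _; exact: rnorm_ge0. Qed.

Lemma rep_ext_l1 pi x (v : pi) : rnorm (rep_ext x v) <= l1norm x * rnorm v.
Proof.
rewrite (le_trans (rnorm_sum _ _))// /l1norm mulr_suml ler_sum// => g _.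
by rewrite rnormZ rep_act_norm.
Qed.

Lemma rep_extP pi x (v : pi) : rnorm (rep_ext x v) <= rep_norm pi x * rnorm v.
Proof.
rewrite /rep_norm.
apply: (@best_constantP _ _ (fun v : pi => rnorm (rep_ext x v))
  (fun v => rnorm v) _ v (l1norm_ge0 x)) => w; first exact: rnorm_ge0.
exact: rep_ext_l1.
Qed.

Lemma rep_norm_ge0 pi x : 0 <= rep_norm pi x.
Proof. exact: best_constant_ge0. Qed.

Lemma rep_norm_le_cstar pi x : rep_norm pi x <= cstar_norm x.
Proof.
apply: ub_le_sup; last by exists pi.
exists (l1norm x) => _ [rho ->].
by apply: best_constant_le; [exact: l1norm_ge0|exact: rep_ext_l1].
Qed.

Lemma cstar_norm_le x M : 0 <= M -> (forall pi, rep_norm pi x <= M) ->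
  cstar_norm x <= M.
Proof.
move=> M0 h; rewrite /cstar_norm; set S := [set _ | _].
have [[r Sr]|S0] := pselect (S !=set0).
  by apply: ge_sup; [exists r|move=> _ [pi ->]].
suff -> : S = set0 by rewrite sup0.
by rewrite -subset0 => r Sr; apply: S0; exists r.
Qed.

Lemma cstar_norm_ge0 x : 0 <= cstar_norm x.
Proof.
rewrite /cstar_norm; set S := [set _ | _].
have [[_ [pi _]]|S0] := pselect (S !=set0).
  exact: le_trans (rep_norm_ge0 pi x) (rep_norm_le_cstar pi x).
suff -> : S = set0 by rewrite sup0.
by rewrite -subset0 => r Sr; apply: S0; exists r.
Qed.

Lemma cstar_normP pi x (v : pi) : rnorm (rep_ext x v) <= cstar_norm x * rnorm v.
Proof.
rewrite (le_trans (rep_extP _ _))// ler_wpM2r ?rnorm_ge0//.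
exact: rep_norm_le_cstar.
Qed.

Lemma rep_ext_mul pi x y (v : pi) :
  rep_ext (cg_mul x y) v = rep_ext x (rep_ext y v).
Proof.
rewrite /rep_ext cg_ext_mul; apply: eq_bigr => g _; congr (_ *: _).
rewrite linear_sum; apply: eq_bigr => h _.
by rewrite linearZ rep_actM.
Qed.

Lemma cstar_normM x y : cstar_norm (cg_mul x y) <= cstar_norm x * cstar_norm y.
Proof.
have n0 := (cstar_norm_ge0 x, cstar_norm_ge0 y).
apply: cstar_norm_le => [|pi]; first by rewrite mulr_ge0 ?n0.
apply: best_constant_le => [|v]; first by rewrite mulr_ge0 ?n0.
rewrite rep_ext_mul (le_trans (cstar_normP _ _))// -mulrA ler_wpM2l ?n0//.
exact: cstar_normP.
Qed.

Lemma cstar_norm_delta (c : C) g : cstar_norm (delta c g) <= rnorm (c : C^o).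
Proof.
apply: cstar_norm_le => [|pi]; first exact: rnorm_ge0.
apply: best_constant_le => [|v]; first exact: rnorm_ge0.
by rewrite /rep_ext cg_extU rnormZ rep_act_norm.
Qed.

Lemma hdotC pi (v w : pi) : hdot pi v w = (hdot pi w v)^*.
Proof. by rewrite {1}hermitian_subproof expr0 mul1r. Qed.

Lemma rep_ext_star pi x (v w : pi) :
  hdot pi (rep_ext (cg_star x) v) w = hdot pi v (rep_ext x w).
Proof.
rewrite /rep_ext cg_ext_star linear_sumlz linear_sumr.
apply: eq_bigr => g _; rewrite linearZl_LR linearZr_LR/=; congr (_ * _).
by rewrite -(rep_unitary g) -rep_actM mulgV rep_act1.
Qed.

Lemma cauchy_schwarz pi (v w : pi) :
  rnorm (hdot pi v w : C^o) <= rnorm v * rnorm w.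
Proof.
have [->|w0] := eqVneq w 0; first by rewrite linear0r rnorm0 mulr_ge0 ?rnorm_ge0.
have hw : 0 < hdot pi w w by exact: neq0_dnorm_gt0.
set a := hdot pi v w; set b := hdot pi w w.
have bR : b^* = b by rewrite /b -hdotC.
have wv : hdot pi w v = a^* by rewrite hdotC.
have : 0 <= hdot pi (b *: v - a *: w) (b *: v - a *: w).
  by rewrite hdot_norm exprn_ge0.
rewrite linearBl/= !linearBr/= !linearZl_LR !linearZr_LR/= wv bR -/a -/b.
rewrite (_ : _ - _ = b * (b * hdot pi v v - a * a^*)); last by ring.
rewrite pmulr_rge0// subr_ge0 -normCK hdot_norm => h.
rewrite -(@ler_pXn2r _ 2)// ?nnegrE ?mulr_ge0 ?rnorm_ge0//.
by rewrite -lecR !rmorphXn/= rmorphM/= !rnormE exprMn mulrC -hdot_norm.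
Qed.

Lemma cstar_norm_star x : cstar_norm (cg_star x) <= cstar_norm x.
Proof.
apply: cstar_norm_le => [|pi]; first exact: cstar_norm_ge0.
apply: best_constant_le => [|v]; first exact: cstar_norm_ge0.
set w := rep_ext _ v.
have [->|w0] := eqVneq (rnorm w) 0.
  by rewrite mulr_ge0 ?rnorm_ge0 ?cstar_norm_ge0.
have wp : 0 < rnorm w by rewrite lt_def w0 rnorm_ge0.
rewrite -(ler_pM2r wp) -expr2.
have -> : rnorm w ^+ 2 = rnorm (hdot pi v (rep_ext x w) : C^o).
  apply: complexI; rewrite rnorm_dot rnormE -rep_ext_star -/w.
  by rewrite ger0_norm// hdot_norm exprn_ge0.
rewrite (le_trans (cauchy_schwarz _ _))// mulrC -mulrA (mulrC (rnorm v)) mulrA.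
by rewrite ler_wpM2r ?rnorm_ge0// cstar_normP.
Qed.

End cstar_norm.

Section fourier_stieltjes.
Variables (R : realType) (G : groupType).
Local Notation C := R[i].
Local Notation CG := {malg C[G]}.
Implicit Types (x y : CG) (g h : G) (f : G -> C).

(* B(G) as the dual of C*(G): a bounded functional on C*(G) is given by its
   restriction to the dense subspace C[G], which is the pairing with a function
   f on G and is bounded for [cstar_norm]. *)
Definition fs_pred : {pred G -> C} := fun f =>
  `[< exists M : R, forall x, rnorm (pairing f x : C^o) <= M * cstar_norm x >].

Lemma fs_predP f : f \in fs_pred ->
  exists2 M : R, 0 <= M & forall x, rnorm (pairing f x : C^o) <= M * cstar_norm x.
Proof.
move=> /asboolP[M hM]; exists `|M| => // x.
by rewrite (le_trans (hM x))// ler_wpM2r ?cstar_norm_ge0 ?ler_norm.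
Qed.

Lemma pairing_lin (a : C) f1 f2 x :
  pairing (a *: f1 + f2) x = a * pairing f1 x + pairing f2 x.
Proof.
rewrite /pairing mulr_sumr -big_split/=; apply: eq_bigr => g _.
by rewrite fctE mulrDl mulrA.
Qed.

Fact fs_pred_submod : submod_closed fs_pred.
Proof.
split=> [|a f1 f2 /fs_predP[M1 M10 h1] /fs_predP[M2 M20 h2]].
  apply/asboolP; exists 0 => x; rewrite /pairing big1 ?rnorm0 ?mul0r// => g _.
  by rewrite mul0r.
apply/asboolP; exists (rnorm (a : C^o) * M1 + M2) => x.
rewrite pairing_lin (le_trans (rnormD _ _))// mulrDl lerD//.
by rewrite rnormZ -mulrA ler_wpM2l ?rnorm_ge0.
Qed.

HB.instance Definition _ := GRing.isSubmodClosed.Build C (G -> C) fs_pred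
  fs_pred_submod.

Record fourier_stieltjes := FourierStieltjes {
  fs_fun :> G -> C ;
  fs_funP : fs_fun \in fs_pred
}.

HB.instance Definition _ := [isSub for fs_fun].
HB.instance Definition _ := [Choice of fourier_stieltjes by <:].
HB.instance Definition _ := [SubChoice_isSubLmodule of fourier_stieltjes by <:].

End fourier_stieltjes.

Section fs_norm.
Context {R : realType} {G : groupType}.
Local Notation C := R[i].
Local Notation CG := {malg C[G]}.
Local Notation BG := (fourier_stieltjes R G).
Implicit Types (x y : CG) (g h : G) (phi psi : BG).

Lemma fsP phi psi : (forall g, phi g = psi g) -> phi = psi.
Proof. by move=> h; apply/val_inj/funext. Qed.

Lemma fsDE phi psi g : (phi + psi) g = phi g + psi g. Proof. by []. Qed.
Lemma fsZE (a : C) phi g : (a *: phi) g = a * phi g. Proof. by []. Qed.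
Lemma fs0E g : (0 : BG) g = 0. Proof. by []. Qed.

(* The norm of B(G) is that of the dual of C*(G). *)
Definition fs_norm phi : R :=
  best_constant (fun x => rnorm (pairing phi x : C^o)) (fun x => cstar_norm x).

Lemma fs_norm_ge0 phi : 0 <= fs_norm phi.
Proof. exact: best_constant_ge0. Qed.

Lemma fs_normP phi x : rnorm (pairing phi x : C^o) <= fs_norm phi * cstar_norm x.
Proof.
have [M M0 hM] := fs_predP (fs_funP phi).
exact: (@best_constantP _ _ (fun x => rnorm (pairing phi x : C^o))
  (fun x => cstar_norm x) _ x M0 (fun x => cstar_norm_ge0 x)).
Qed.

Lemma fs_norm_le phi M : 0 <= M ->
  (forall x, rnorm (pairing phi x : C^o) <= M * cstar_norm x) -> fs_norm phi <= M.
Proof. exact: best_constant_le. Qed.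

Lemma pairing_delta (f : G -> C) g : pairing f (delta 1 g) = f g.
Proof. by rewrite pairingE cg_extU scale1r. Qed.

Lemma fs_normD phi psi : fs_norm (phi + psi) <= fs_norm phi + fs_norm psi.
Proof.
apply: fs_norm_le => [|x]; first by rewrite addr_ge0 ?fs_norm_ge0.
have -> : pairing (phi + psi) x = pairing phi x + pairing psi x.
  by have := pairing_lin 1 phi psi x; rewrite scale1r mul1r.
by rewrite (le_trans (rnormD _ _))// mulrDl lerD ?fs_normP.
Qed.

Lemma pairingZ (a : C) phi x : pairing (a *: phi) x = a * pairing phi x.
Proof.
by rewrite /pairing mulr_sumr; apply: eq_bigr => g _; rewrite mulrA.
Qed.

Lemma fs_normZ_le (a : C) phi : fs_norm (a *: phi) <= rnorm (a : C^o) * fs_norm phi.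
Proof.
apply: fs_norm_le => [|x]; first by rewrite mulr_ge0 ?rnorm_ge0 ?fs_norm_ge0.
by rewrite pairingZ rnormZ -mulrA ler_wpM2l ?rnorm_ge0 ?fs_normP.
Qed.

Lemma fs_normZ (a : C) phi : fs_norm (a *: phi) = rnorm (a : C^o) * fs_norm phi.
Proof.
have [->|a0] := eqVneq a 0.
  rewrite scale0r rnorm0 mul0r; apply/eqP; rewrite eq_le fs_norm_ge0 andbT.
  by have := fs_normZ_le 0 0; rewrite scaler0 rnorm0 mul0r.
apply/eqP; rewrite eq_le fs_normZ_le/=.
have := fs_normZ_le a^-1 (a *: phi); rewrite scalerA mulVf// scale1r => h.
rewrite (le_trans (ler_wpM2l (rnorm_ge0 _) h))// mulrA -rnormZ.
rewrite [_ *: _](_ : _ = a * a^-1)// divff// /rnorm normr1/= mul1r//.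
Qed.

Lemma fs_norm_eq0 phi : fs_norm phi = 0 -> phi = 0.
Proof.
move=> phi0; apply: fsP => g; rewrite -pairing_delta.
apply: (@rnorm_eq0 _ C^o); apply/eqP; rewrite eq_le rnorm_ge0 andbT.
by rewrite (le_trans (fs_normP _ _))// phi0 mul0r.
Qed.

Fact fs_normC_triangle phi psi :
  (fs_norm (phi + psi))%:C <= (fs_norm phi)%:C + (fs_norm psi)%:C.
Proof. by rewrite -rmorphD/= lecR fs_normD. Qed.

Fact fs_normCZ (a : C) phi : (fs_norm (a *: phi))%:C = `|a| * (fs_norm phi)%:C.
Proof. by rewrite fs_normZ rmorphM/= rnormE. Qed.

Fact fs_normC_eq0 phi : (fs_norm phi)%:C = 0 -> phi = 0.
Proof. by move=> /complexI; exact: fs_norm_eq0. Qed.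

End fs_norm.

HB.instance Definition _ (R : realType) (G : groupType) :=
  Lmodule_isNormed.Build R[i] (fourier_stieltjes R G)
    (@fs_normC_triangle R G) (@fs_normCZ R G) (@fs_normC_eq0 R G).

Lemma fs_normE (R : realType) (G : groupType) (phi : fourier_stieltjes R G) :
  rnorm phi = fs_norm phi.
Proof. by []. Qed.

Section translations.
Context {R : realType} {G : groupType}.
Local Notation C := R[i].
Local Notation CG := {malg C[G]}.
Local Notation BG := (fourier_stieltjes R G).
Implicit Types (x y : CG) (g h : G) (phi psi : BG).

Lemma pairing_mul phi x y :
  pairing phi (cg_mul x y) = cg_ext (fun g => cg_ext (fun h => phi (g * h)%g : C^o) y) x.
Proof. by rewrite pairingE cg_ext_mul. Qed.

Fact ltrans_subproof g phi : (fun h => phi (h * g)%g) \in @fs_pred R G.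
Proof.
apply/asboolP; exists (fs_norm phi) => x.
have -> : pairing (fun h => phi (h * g)%g) x = pairing phi (cg_mul x (delta 1 g)).
  rewrite pairing_mul pairingE; apply: eq_bigr => h _.
  by rewrite cg_extU scale1r.
rewrite (le_trans (fs_normP _ _))// ler_wpM2l ?fs_norm_ge0//.
rewrite (le_trans (cstar_normM _ _))// -[leRHS]mulr1 ler_wpM2l ?cstar_norm_ge0//.
by rewrite (le_trans (cstar_norm_delta _ _))// /rnorm normr1.
Qed.

Fact rtrans_subproof phi g : (fun h => phi (g * h)%g) \in @fs_pred R G.
Proof.
apply/asboolP; exists (fs_norm phi) => x.
have -> : pairing (fun h => phi (g * h)%g) x = pairing phi (cg_mul (delta 1 g) x).
  by rewrite pairing_mul pairingE cg_extU scale1r.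
rewrite (le_trans (fs_normP _ _))// ler_wpM2l ?fs_norm_ge0//.
rewrite (le_trans (cstar_normM _ _))// -[leRHS]mul1r ler_wpM2r ?cstar_norm_ge0//.
by rewrite (le_trans (cstar_norm_delta _ _))// /rnorm normr1.
Qed.

Fact fs_star_subproof phi : (fun h => (phi (h^-1)%g)^*) \in @fs_pred R G.
Proof.
apply/asboolP; exists (fs_norm phi) => x.
have -> : pairing (fun h => (phi (h^-1)%g)^*) x = (pairing phi (cg_star x))^*.
  rewrite [in RHS]pairingE cg_ext_star rmorph_sum; apply: eq_bigr => h _.
  by rewrite rmorphM/= conjCK mulrC.
rewrite /rnorm norm_conjC -/(rnorm (pairing _ _ : C^o)).
rewrite (le_trans (fs_normP _ _))// ler_wpM2l ?fs_norm_ge0//.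
exact: cstar_norm_star.
Qed.

(* [ltrans g phi] and [rtrans phi g] are g phi and phi g for the left and right
   actions of G on its functionals: (g phi)(y) = phi(y g), (phi g)(y) = phi(g y). *)
Definition ltrans g phi : BG := FourierStieltjes (ltrans_subproof g phi).
Definition rtrans phi g : BG := FourierStieltjes (rtrans_subproof phi g).
Definition fs_star phi : BG := FourierStieltjes (fs_star_subproof phi).

Lemma fs_sumE (I : Type) (s : seq I) (F : I -> BG) g :
  (\sum_(i <- s) F i) g = \sum_(i <- s) F i g.
Proof. by elim/big_rec2: _ => [//|i a b _ <-]; rewrite fsDE. Qed.

Lemma cg_ext_rtransE phi x h : cg_ext (rtrans phi) x h = cg_ext (fun g => phi (g * h)%g : C^o) x.
Proof. by rewrite /cg_ext fs_sumE. Qed.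

Lemma cg_ext_ltransE phi x h : cg_ext (ltrans^~ phi) x h = cg_ext (fun g => phi (h * g)%g : C^o) x.
Proof. by rewrite /cg_ext fs_sumE. Qed.

Lemma cg_ext_exchange (L : G -> G -> C^o) x y :
  cg_ext (fun g => cg_ext (L g) y) x = cg_ext (fun h => cg_ext (L^~ h) x) y.
Proof.
rewrite /cg_ext; under eq_bigr do rewrite scaler_sumr.
rewrite exchange_big/=; apply: eq_bigr => h _; rewrite scaler_sumr.
by apply: eq_bigr => g _; rewrite !scalerA mulrC.
Qed.

Lemma fs_norm_rtrans phi x : fs_norm (cg_ext (rtrans phi) x) <= fs_norm phi * cstar_norm x.
Proof.
apply: fs_norm_le => [|y]; first by rewrite mulr_ge0 ?fs_norm_ge0 ?cstar_norm_ge0.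
have -> : pairing (cg_ext (rtrans phi) x) y = pairing phi (cg_mul x y).
  rewrite pairing_mul cg_ext_exchange pairingE; apply: eq_bigr => h _.
  by rewrite cg_ext_rtransE.
rewrite (le_trans (fs_normP _ _))// -mulrA ler_wpM2l ?fs_norm_ge0//.
exact: cstar_normM.
Qed.

Lemma fs_norm_ltrans phi x : fs_norm (cg_ext (ltrans^~ phi) x) <= fs_norm phi * cstar_norm x.
Proof.
apply: fs_norm_le => [|y]; first by rewrite mulr_ge0 ?fs_norm_ge0 ?cstar_norm_ge0.
have -> : pairing (cg_ext (ltrans^~ phi) x) y = pairing phi (cg_mul y x).
  rewrite pairing_mul pairingE; apply: eq_bigr => h _.
  by rewrite cg_ext_ltransE.
rewrite (le_trans (fs_normP _ _))// -mulrA ler_wpM2l ?fs_norm_ge0// mulrC.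
exact: cstar_normM.
Qed.

Lemma fs_norm_star phi : fs_norm (fs_star phi) <= fs_norm phi.
Proof.
apply: fs_norm_le => [|x]; first exact: fs_norm_ge0.
have -> : pairing (fs_star phi) x = (pairing phi (cg_star x))^*.
  rewrite [in RHS]pairingE cg_ext_star rmorph_sum; apply: eq_bigr => h _.
  by rewrite rmorphM/= conjCK mulrC.
rewrite /rnorm norm_conjC -/(rnorm (pairing _ _ : C^o)).
rewrite (le_trans (fs_normP _ _))// ler_wpM2l ?fs_norm_ge0//.
exact: cstar_norm_star.
Qed.

Lemma rtrans_lin (a : C) phi psi g :
  rtrans (a *: phi + psi) g = a *: rtrans phi g + rtrans psi g.
Proof. exact: fsP. Qed.

Lemma ltrans_lin (a : C) phi psi g :
  ltrans g (a *: phi + psi) = a *: ltrans g phi + ltrans g psi.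
Proof. exact: fsP. Qed.

Lemma rtransM phi g h : rtrans (rtrans phi g) h = rtrans phi (g * h)%g.
Proof. by apply: fsP => k /=; rewrite mulgA. Qed.

End translations.

Section wstar.
Variables (R : realType) (G : groupType).
Local Notation C := R[i].
Local Notation BG := (fourier_stieltjes R G).

(* W*(G) = B(G)^* = C*(G)** *)
Definition wstar_pred : {pred BG -> C^o} := fun a =>
  `[< linear a /\ continuous a >].

Lemma wstar_predP (a : BG -> C^o) : a \in wstar_pred ->
  linear a /\ exists2 M : R, 0 <= M & forall phi, rnorm (a phi) <= M * fs_norm phi.
Proof.
move=> /asboolP[la ca]; split=> //.
pose L := GRing.isLinear.Build _ _ _ _ a la.
pose f : {linear BG -> C^o} := HB.pack a L.
have /(@linear_bounded_continuous C BG C^o f)/linear_boundedP := ca.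
move=> /pinfty_ex_gt0[r r0 hr]; exists (complex.Re r) => [|phi].
  by rewrite -ler0c RRe_real ?ltW// gtr0_real.
by rewrite -lecR rmorphM/= rnormE RRe_real ?gtr0_real ?hr.
Qed.

Lemma wstar_predI (a : BG -> C^o) : linear a ->
  (exists M : R, forall phi, rnorm (a phi) <= M * fs_norm phi) -> a \in wstar_pred.
Proof.
move=> la [M hM]; apply/asboolP; split=> //.
pose L := GRing.isLinear.Build _ _ _ _ a la.
pose f : {linear BG -> C^o} := HB.pack a L.
apply/(@linear_bounded_continuous C BG C^o f)/linear_boundedP.
exists `|M|%:C; split; first by apply: ger0_real; rewrite ler0c.
move=> r Mr phi; rewrite -rnormE (le_trans _ (ler_wpM2r _ (ltW Mr)))//.
rewrite -(rnormE phi) -rmorphM/= lecR (le_trans (hM phi))//.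
by rewrite ler_wpM2r ?ler_norm ?fs_norm_ge0.
Qed.

Fact wstar_pred_submod : submod_closed wstar_pred.
Proof.
split=> [|c a b /wstar_predP[la [M M0 hM]] /wstar_predP[lb [N N0 hN]]].
  apply: wstar_predI => [c phi psi|]; first by rewrite /= scaler0 addr0.
  by exists 0 => phi; rewrite rnorm0 mul0r.
apply: wstar_predI => [d phi psi|].
  change (c * a (d *: phi + psi) + b (d *: phi + psi) =
    d * (c * a phi + b phi) + (c * a psi + b psi)).
  have -> : a (d *: phi + psi) = d * a phi + a psi by exact: la.
  have -> : b (d *: phi + psi) = d * b phi + b psi by exact: lb.
  by ring.
exists (rnorm (c : C^o) * M + N) => phi.
rewrite (le_trans (rnormD _ _))// mulrDl lerD// rnormZ -mulrA.
by rewrite ler_wpM2l ?rnorm_ge0.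
Qed.

HB.instance Definition _ := GRing.isSubmodClosed.Build C (BG -> C^o) wstar_pred
  wstar_pred_submod.

Record wstar := WStar {
  wstar_fun :> BG -> C^o ;
  wstar_funP : wstar_fun \in wstar_pred
}.

HB.instance Definition _ := [isSub for wstar_fun].
HB.instance Definition _ := [Choice of wstar by <:].
HB.instance Definition _ := [SubChoice_isSubLmodule of wstar by <:].

End wstar.

Section wstar_structure.
Context {R : realType} {G : groupType}.
Local Notation C := R[i].
Local Notation CG := {malg C[G]}.
Local Notation BG := (fourier_stieltjes R G).
Local Notation WG := (wstar R G).
Implicit Types (x y : CG) (g h : G) (phi psi : BG) (a b c : WG).

Lemma wstarP a b : (forall phi, a phi = b phi) -> a = b.
Proof. by move=> h; apply/val_inj/funext. Qed.

Lemma wstarDE a b phi : (a + b) phi = a phi + b phi. Proof. by []. Qed.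
Lemma wstarZE (k : C) a phi : (k *: a) phi = k * a phi. Proof. by []. Qed.

Lemma wstar_lin a (k : C) phi psi : a (k *: phi + psi) = k * a phi + a psi.
Proof. by have [+ _] := wstar_predP (wstar_funP a); apply. Qed.

Lemma wstarD a phi psi : a (phi + psi) = a phi + a psi.
Proof. by have := wstar_lin a 1 phi psi; rewrite scale1r mul1r. Qed.

Lemma wstar0 a : a 0 = 0.
Proof. by apply: (@addrI _ (a 0)); rewrite -wstarD !addr0. Qed.

Lemma wstarZ a (k : C) phi : a (k *: phi) = k * a phi.
Proof. by rewrite -[k *: phi]addr0 wstar_lin wstar0 addr0. Qed.

Lemma wstar_cg_ext a (L : G -> BG) x :
  a (cg_ext L x) = pairing (fun g => a (L g)) x.
Proof.
rewrite /cg_ext /pairing; elim/big_rec2: _ => [|g u v _ <-]; first exact: wstar0.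
by rewrite wstarD wstarZ mulrC.
Qed.

Lemma wstar_bounded a : exists2 M : R,
  0 <= M & forall phi, rnorm (a phi : C^o) <= M * fs_norm phi.
Proof. by have [_] := wstar_predP (wstar_funP a). Qed.

Lemma wact_bound a phi (M : R) : 0 <= M ->
    (forall psi, rnorm (a psi : C^o) <= M * fs_norm psi) ->
  forall x, rnorm (pairing (fun g => a (rtrans phi g)) x : C^o)
    <= M * fs_norm phi * cstar_norm x.
Proof.
move=> M0 hM x; rewrite -wstar_cg_ext (le_trans (hM _))// -mulrA ler_wpM2l//.
exact: fs_norm_rtrans.
Qed.

Fact wact_l_subproof a phi : (fun g => a (rtrans phi g)) \in @fs_pred R G.
Proof.
have [M M0 hM] := wstar_bounded a.
by apply/asboolP; exists (M * fs_norm phi); exact: wact_bound.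
Qed.

Fact wact_r_subproof phi a : (fun g => a (ltrans g phi)) \in @fs_pred R G.
Proof.
have [M M0 hM] := wstar_bounded a.
apply/asboolP; exists (M * fs_norm phi) => x.
rewrite -wstar_cg_ext (le_trans (hM _))// -mulrA ler_wpM2l//.
exact: fs_norm_ltrans.
Qed.

(* The actions (a phi)(y) = phi(y a) and (phi a)(y) = phi(a y) of W*(G) on B(G).
   An element of B(G) is given by its values at y in G, and
   phi(g a) = a(phi g), phi(a g) = a(g phi). *)
Definition wact_l a phi : BG := FourierStieltjes (wact_l_subproof a phi).
Definition wact_r phi a : BG := FourierStieltjes (wact_r_subproof phi a).

Lemma fs_norm_wact_l a phi (M : R) : 0 <= M ->
    (forall psi, rnorm (a psi : C^o) <= M * fs_norm psi) ->
  fs_norm (wact_l a phi) <= M * fs_norm phi.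
Proof.
move=> M0 hM; apply: fs_norm_le; first by rewrite mulr_ge0 ?fs_norm_ge0.
exact: wact_bound.
Qed.

Lemma wact_lD a b phi : wact_l (a + b) phi = wact_l a phi + wact_l b phi.
Proof. exact: fsP. Qed.

Lemma wact_l_lin a (k : C) phi psi :
  wact_l a (k *: phi + psi) = k *: wact_l a phi + wact_l a psi.
Proof. by apply: fsP => g; rewrite /= rtrans_lin wstar_lin. Qed.

Fact wstar_mul_subproof a b : (fun phi => a (wact_l b phi)) \in @wstar_pred R G.
Proof.
apply: wstar_predI => [k phi psi|]; first by rewrite /= wact_l_lin wstar_lin.
have [M M0 hM] := wstar_bounded a; have [N N0 hN] := wstar_bounded b.
exists (M * N) => phi; rewrite (le_trans (hM _))// -mulrA ler_wpM2l//.
exact: fs_norm_wact_l.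
Qed.

Fact wstar_iota_subproof x : (fun phi => pairing phi x) \in @wstar_pred R G.
Proof.
apply: wstar_predI => [k phi psi|]; first exact: pairing_lin.
by exists (cstar_norm x) => phi; rewrite mulrC; exact: fs_normP.
Qed.

Fact wstar_star_subproof a : (fun phi => (a (fs_star phi))^*) \in @wstar_pred R G.
Proof.
apply: wstar_predI => [k phi psi|].
  have -> : fs_star (k *: phi + psi) = k^* *: fs_star phi + fs_star psi.
    by apply: fsP => g /=; rewrite rmorphD rmorphM.
  by rewrite wstar_lin rmorphD rmorphM/= conjCK.
have [M M0 hM] := wstar_bounded a; exists M => phi.
rewrite /rnorm norm_conjC -/(rnorm (a _ : C^o)) (le_trans (hM _))//.
by rewrite ler_wpM2l ?fs_norm_star.
Qed.

(* The Arens product of the bidual C*(G)**: (a b)(phi) = a(b phi). *)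
Definition wstar_mul a b : WG := WStar (wstar_mul_subproof a b).

(* The embedding of C[G] in W*(G). *)
Definition wstar_iota x : WG := WStar (wstar_iota_subproof x).

Definition wstar_one : WG := wstar_iota (delta 1 1%g).

(* The involution of the bidual: a^*(phi) = conj (a(phi^* )), where phi^* is
   such that phi^*(x) = conj (phi(x^* )) for x in C[G]. *)
Definition wstar_star a : WG := WStar (wstar_star_subproof a).

Lemma wact_l_rtrans a phi g : rtrans (wact_l a phi) g = wact_l a (rtrans phi g).
Proof. by apply: fsP => h /=; rewrite rtransM. Qed.

Lemma wact_l_mul a b phi : wact_l (wstar_mul a b) phi = wact_l a (wact_l b phi).
Proof. by apply: fsP => g /=; rewrite wact_l_rtrans. Qed.

Fact wstar_mulA : associative wstar_mul.
Proof. by move=> a b c; apply: wstarP => phi /=; rewrite wact_l_mul. Qed.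

Fact wstar_mul1 : left_id wstar_one wstar_mul.
Proof.
move=> a; apply: wstarP => phi /=; rewrite pairing_delta/=.
by congr (a _); apply: fsP => g /=; rewrite mul1g.
Qed.

Fact wstar_1mul : right_id wstar_one wstar_mul.
Proof.
move=> a; apply: wstarP => phi /=; congr (a _); apply: fsP => g /=.
by rewrite pairing_delta/= mulg1.
Qed.

Fact wstar_mulDl : left_distributive wstar_mul +%R.
Proof. by move=> a b c; exact: wstarP. Qed.

Fact wstar_mulDr : right_distributive wstar_mul +%R.
Proof.
by move=> a b c; apply: wstarP => phi /=; rewrite wact_lD wstarD.
Qed.

End wstar_structure.

HB.instance Definition _ (R : realType) (G : groupType) :=
  GRing.Zmodule_isPzRing.Build (wstar R G) wstar_mulA wstar_mul1 wstar_1mul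
    wstar_mulDl wstar_mulDr.

Section wstar_theory.
Context {R : realType} {G : groupType}.
Local Notation C := R[i].
Local Notation CG := {malg C[G]}.
Local Notation BG := (fourier_stieltjes R G).
Local Notation WG := (wstar R G).
Implicit Types (x y : CG) (g h : G) (phi psi : BG) (a b : WG).

Lemma wact_lP a b phi : b (wact_l a phi) = (b * a) phi.
Proof. by []. Qed.

Lemma wact_r_iotaP x b phi : b (wact_r phi (wstar_iota x)) = (wstar_iota x * b) phi.
Proof.
rewrite [RHS]/=.
have -> : wact_r phi (wstar_iota x) = cg_ext (rtrans phi) x.
  by apply: fsP => h; rewrite cg_ext_rtransE /= pairingE.
exact: wstar_cg_ext.
Qed.

Lemma wact_l_iotaE x phi h :
  wact_l (wstar_iota x) phi h = \sum_(g <- msupp x) x@_g * phi (h * g)%g.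
Proof. by rewrite /= pairingE. Qed.

Lemma wact_r_iotaE x phi h :
  wact_r phi (wstar_iota x) h = \sum_(g <- msupp x) x@_g * phi (g * h)%g.
Proof. by rewrite /= pairingE. Qed.

Lemma wstar_iotaM x y : wstar_iota (cg_mul x y) = wstar_iota x * wstar_iota y.
Proof.
apply: wstarP => phi; rewrite /= pairing_mul pairingE; apply: eq_bigr => g _.
by rewrite /= pairingE.
Qed.

Lemma wstar_iota_star x : wstar_iota (cg_star x) = wstar_star (wstar_iota x).
Proof.
apply: wstarP => phi; rewrite /= pairingE cg_ext_star rmorph_sum.
by apply: eq_bigr => g _; rewrite rmorphM/= conjCK mulrC.
Qed.

Definition is_projection a := a * a = a /\ wstar_star a = a.

Definition is_central a := forall b, a * b = b * a.

Definition is_central_projection a := is_projection a /\ is_central a.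

Definition proj_le a b := a * b = a.

(* [phi] vanishes on (1 - a) W*(G); an element b of W*(G) takes the value
   b(phi) at phi. *)
Definition supported_by phi a := forall b, ((1 - a) * b) phi = 0.

Definition is_central_support phi a :=
  [/\ is_central_projection a, supported_by phi a &
      forall b, is_central_projection b -> supported_by phi b -> proj_le a b].

(* The central support exists and is unique, W*(G) being a von Neumann algebra:
   the default value 0 of [xget] is never used. *)
Definition central_support phi : WG := xget 0 [set a | is_central_support phi a].

(* phi << psi *)
Definition abs_continuous phi psi :=
  proj_le (central_support phi) (central_support psi).

Definition is_subspace (X : set BG) :=
  X 0 /\ forall (k : C) phi psi, X phi -> X psi -> X (k *: phi + psi).

Definition is_L_space (X : set BG) :=
  forall phi psi, X phi -> abs_continuous psi phi -> X psi.

Definition is_biinvariant (X : set BG) :=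
  (forall x phi, X phi -> X (wact_l (wstar_iota x) phi)) /\
  (forall x phi, X phi -> X (wact_r phi (wstar_iota x))).

End wstar_theory.

(* Main.v *)
(* Every phi in B(G) is a coefficient <pi(g) v, w> of a unitary representation,
   with |v|^2 and |w|^2 at most |phi|: a Hahn-Banach argument makes phi the
   off-diagonal corner of a positive functional on the 2 x 2 matrices over C*(G),
   to which the GNS construction applies.

   Let X be a closed bi-invariant subspace of B(G). In a unitary representation,
   let P be the orthogonal projection onto the vectors v such that all the
   coefficients <pi(g) v, w> are in X. As P commutes with intertwiners that have
   an adjoint, <P v, w> only depends on the coefficient <pi(g) v, w>, so that it
   defines an element z of W*(G); this is a central projection and X = z B(G).
   The centrality of z uses that b in W*(G) maps the coefficient of v and w to
   that of u and w, for the vector u representing w |-> b(<pi(.) v, w>).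

   The smallest closed bi-invariant subspace containing phi yields the central
   support of phi, and the other implications follow from its properties. *)
Require Import Defs.
From HB Require Import structures.
From mathcomp Require Import all_boot all_order all_algebra.
From mathcomp Require Import finmap sesquilinear complex.
(* The notations of [monalg] clash with those of MathComp-Analysis. *)
From mathcomp.multinomials Require Import -(notations) monalg.
From mathcomp Require Import boolp classical_sets functions reals.
From mathcomp Require Import topology normedtype.
From mathcomp Require Import ring lra.

Set Implicit Arguments.
Unset Strict Implicit.
Unset Printing Implicit Defensive.

Import Order.TTheory GRing.Theory Num.Theory.
Import numFieldNormedType.Exports.

Local Open Scope classical_set_scope.
Local Open Scope ring_scope.

Local Notation "{ 'malg' A [ K ] }" := (@malg K A)
  (at level 0, K, A at level 2, format "{ 'malg'  A [ K ] }") : type_scope.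
Local Notation "x @_ g" := (mcoeff g x)
  (at level 3, g at level 2, left associativity, format "x @_ g") : ring_scope.
Local Notation delta c g := (mkmalgU g c).
Local Notation "r %:C" := (real_complex _ r) : ring_scope.
Local Notation Re := complex.Re.
Local Notation Im := complex.Im.

(** * Complex numbers and normed modules *)

(** The usual source of such coefficients is the polar decomposition of phi in the predual of a von
    Neumann algebra; here [wstar] is used only as the dual of B(G) with the Arens product, and
    Hahn-Banach with GNS takes the place of that decomposition. The bounds on |v|^2 and |w|^2 are
    what makes z bounded: |<P v, w>| <= |v| |w| <= |phi|.

    That <P v, w> depends on the coefficient only is reduced to the zero coefficient: two
    expressions of the same phi are subtracted in a direct sum of representations.

    The two halves of bi-invariance do different work. Left translations make the range of P a
    subrepresentation, so that P commutes with G, which centrality needs. Right translations make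
    the set of all u such that the coefficient of v and u is in X a subrepresentation; moving its
    projection from one side of the inner product to the other shows that z fixes X. *)

Section complex_facts.
Context {R : realType}.
Local Notation C := R[i].
Implicit Types (z w : C) (a b : R).

Lemma ReD z w : Re (z + w) = Re z + Re w. Proof. by case: z w => ? ? []. Qed.
Lemma ImD z w : Im (z + w) = Im z + Im w. Proof. by case: z w => ? ? []. Qed.
Lemma ReN z : Re (- z) = - Re z. Proof. by case: z. Qed.
Lemma ImN z : Im (- z) = - Im z. Proof. by case: z. Qed.
Lemma ReC z : Re z^* = Re z. Proof. by case: z. Qed.
Lemma ImC z : Im z^* = - Im z. Proof. by case: z. Qed.
Lemma ReMr a z : Re (a%:C * z) = a * Re z.
Proof. by case: z => x y /=; rewrite mul0r subr0. Qed.
Lemma ReMi z : Re ('i * z) = - Im z.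
Proof. by case: z => x y /=; rewrite mul0r mul1r sub0r. Qed.

Lemma ltr0c a : (0 < a%:C :> C) = (0 < a). Proof. exact: ltcR. Qed.

Lemma complex_eq z w : Re z = Re w -> Im z = Im w -> z = w.
Proof. by case: z w => a b [c d] /= -> ->. Qed.

Lemma conj_real a : (a%:C)^* = a%:C :> C.
Proof. by apply: complex_eq; rewrite ?ReC ?ImC //= oppr0. Qed.

Lemma rnormC2 z : rnorm (z : C^o) ^+ 2 = Re z ^+ 2 + Im z ^+ 2.
Proof.
case: z => x y; rewrite /rnorm normc_def /= sqr_sqrtr// addr_ge0 ?sqr_ge0//.
Qed.

Lemma Re_le_rnorm z : Re z <= rnorm (z : C^o).
Proof.
rewrite (le_trans (ler_norm _))// -(@ler_pXn2r _ 2)// ?nnegrE ?rnorm_ge0//.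
by rewrite real_normK ?num_real// rnormC2 lerDl sqr_ge0.
Qed.

Lemma Im_le_rnorm z : Im z <= rnorm (z : C^o).
Proof.
rewrite (le_trans (ler_norm _))// -(@ler_pXn2r _ 2)// ?nnegrE ?rnorm_ge0//.
by rewrite real_normK ?num_real// rnormC2 lerDr sqr_ge0.
Qed.

Lemma rnorm_le_ReIm z : rnorm (z : C^o) <= `|Re z| + `|Im z|.
Proof.
rewrite -(@ler_pXn2r _ 2)// ?nnegrE ?rnorm_ge0 ?addr_ge0//.
rewrite rnormC2 sqrrD !real_normK ?num_real// -addrA lerD2l lerDr.
by rewrite mulrn_wge0 ?mulr_ge0.
Qed.

Lemma rnorm_real a : rnorm (a%:C : C^o) = `|a|.
Proof.
apply/eqP; rewrite -(@eqrXn2 _ 2)// ?rnorm_ge0// rnormC2 /= expr0n addr0.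
by rewrite real_normK ?num_real.
Qed.

Lemma rnormM z w : rnorm (z * w : C^o) = rnorm (z : C^o) * rnorm (w : C^o).
Proof. exact: (@rnormZ R C^o). Qed.

Lemma rnormCj z : rnorm (z^* : C^o) = rnorm (z : C^o).
Proof. by rewrite /rnorm norm_conjC. Qed.

(** The unimodular number w = z^* / |z| rotates z onto the positive axis. Bounds on real parts thus
    become bounds on moduli. *)
Lemma rnorm_ge_Re z a : (forall w, rnorm (w : C^o) = 1 -> Re (w * z) <= a) ->
  rnorm (z : C^o) <= a.
Proof.
case: (eqVneq z 0) => [-> h|z0 h].
  by rewrite rnorm0; have := h 1; rewrite mulr0; apply; rewrite /rnorm normr1.
have rz : rnorm (z : C^o) != 0 by apply/eqP => /(@rnorm_eq0 _ C^o)/eqP; exact/negP.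
pose r := (rnorm (z : C^o))^-1.
have := h (r%:C * z^*); rewrite rnormM rnormCj rnorm_real ger0_norm; last first.
  by rewrite invr_ge0 rnorm_ge0.
rewrite mulVf// => /(_ erefl); rewrite -mulrA ReMr.
have -> : Re (z^* * z) = rnorm (z : C^o) ^+ 2.
  by rewrite rnormC2; case: (z) => x y /=; ring.
by rewrite expr2 mulrA mulVf// mul1r.
Qed.

End complex_facts.

Section normed.
Context {R : realType} {V : normedModType R[i]}.
Implicit Types (v w : V) (X : set V).

Definition approx X v := forall e : R, 0 < e -> exists2 w, X w & rnorm (v - w) < e.

Lemma rnormN v : rnorm (- v) = rnorm v.
Proof. by rewrite /rnorm normrN. Qed.

Lemma rnorm_distC v w : rnorm (v - w) = rnorm (w - v).
Proof. by rewrite -rnormN opprB. Qed.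

Lemma rnormZr (a : R) v : rnorm (a%:C *: v) = `|a| * rnorm v.
Proof. by rewrite rnormZ rnorm_real. Qed.

Lemma nbhs_rnormP v X :
  nbhs v X <-> exists2 e : R, 0 < e & forall w, rnorm (v - w) < e -> X w.
Proof.
split=> [/nbhs_ballP[e/= e0 h]|[e e0 h]].
  have eR : (Re e)%:C = e by rewrite RRe_real// gtr0_real.
  exists (Re e) => [|w vw]; first by rewrite -ltr0c eR.
  by apply: h; rewrite -ball_normE /ball_/= -rnormE -eR ltcR.
apply/nbhs_ballP; exists e%:C; rewrite /= ?ltr0c// => w.
by rewrite -ball_normE /ball_/= -rnormE ltcR; exact: h.
Qed.

Lemma closed_approx X v : closed X -> approx X v -> X v.
Proof.
move=> cX aX; apply: cX => U /nbhs_rnormP[e e0 h].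
by have [w Xw vw] := aX e e0; exists w; split=> //; exact: h.
Qed.

Lemma approx_closed X : (forall v, approx X v -> X v) -> closed X.
Proof.
move=> h v cv; apply: h => e e0.
have [|w [Xw vw]] := cv [set w | rnorm (v - w) < e]; last by exists w.
by apply/nbhs_rnormP; exists e.
Qed.

End normed.

Section harmonic_bounds.
Context {R : realType}.

(** Minimizing and Cauchy sequences are chosen below with errors controlled by [hinv]; estimates
    then pass to the limit through [le_hinv]. *)
Definition hinv (n : nat) : R := n.+1%:R^-1.

Lemma hinv_gt0 n : 0 < hinv n. Proof. by rewrite invr_gt0. Qed.

Lemma hinv_small (c e : R) : 0 <= c -> 0 < e ->
  exists N, forall n, (N <= n)%N -> c * hinv n < e.
Proof.
move=> c0 e0; exists (Num.bound (c / e)) => n Nn.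
rewrite ltr_pdivrMr// mulrC -ltr_pdivrMr//.
rewrite (lt_le_trans (archi_boundP _)) ?divr_ge0 ?(ltW e0)//.
by rewrite ler_nat (leq_trans Nn).
Qed.

Lemma le_hinv (x y c : R) : 0 <= c -> (forall n, x <= y + c * hinv n) -> x <= y.
Proof.
move=> c0 h; apply/ler_addgt0Pr => e e0.
by have [N /(_ N (leqnn _))/ltW le] := hinv_small c0 e0; rewrite (le_trans (h N))// lerD2l.
Qed.

End harmonic_bounds.

Section complete.
Context {R : realType} {V : completeNormedModType R[i]}.

Lemma complete_seq (u : nat -> V) (c : R) : 0 <= c ->
    (forall n m, rnorm (u n - u m) <= c * (hinv n + hinv m)) ->
  exists l, forall n, rnorm (u n - l) <= c * hinv n.
Proof.
move=> c0 hu.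
have : cauchy (u @ \oo).
  apply/cauchy_ballP => e e0.
  have eR : (Re e)%:C = e by rewrite RRe_real// gtr0_real.
  have e2 : 0 < Re e / 2 by rewrite divr_gt0// -ltr0c eR.
  have [N hN] := hinv_small c0 e2.
  near=> x y; rewrite -ball_normE /ball_/=.
  suff : forall a b, (exists2 n, (N <= n)%N & a = u n) ->
    (exists2 n, (N <= n)%N & b = u n) -> `|a - b| < e.
    apply.
      near: x; exists N => // n /= Nn; by exists n.
    near: y; exists N => // n /= Nn; by exists n.
  move=> _ _ [n Nn ->] [m Nm ->]; rewrite -rnormE -eR ltcR.
  rewrite (le_lt_trans (hu _ _))// mulrDr (splitr (Re e)) ltrD ?hN//.
move=> /cauchy_cvg/cvg_ex[l ul]; exists l => n.
apply/ler_addgt0Pr => e e0.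
have e2 : 0 < e / 2 by rewrite divr_gt0.
have : nbhs l [set w | rnorm (l - w) < e / 2] by apply/nbhs_rnormP; exists (e / 2).
move=> /ul[N _ hN]; have [M hM] := hinv_small c0 e2.
have := hN (maxn N M) (leq_maxl _ _); set m := maxn N M => /= lm.
rewrite -(subrKA (u m)) (le_trans (rnormD _ _))//.
rewrite (le_trans (lerD (hu n m) (lexx _)))// rnorm_distC mulrDr.
rewrite -!addrA lerD2l (splitr e) lerD// ltW//; exact/hM/leq_maxr.
Unshelve. all: by end_near. Qed.

End complete.
(** * Hilbert spaces *)

Definition subspace (K : pzRingType) (V : lmodType K) (X : set V) :=
  X 0 /\ forall (k : K) u v, X u -> X v -> X (k *: u + v).

Section subspace.
Context {K : pzRingType} {V : lmodType K} {X : set V}.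
Hypothesis sX : subspace X.
Implicit Types u v : V.

Lemma subspace0 : X 0. Proof. by case: sX. Qed.

Lemma subspaceD u v : X u -> X v -> X (u + v).
Proof. by move=> Xu Xv; have := sX.2 1 u v Xu Xv; rewrite scale1r. Qed.

Lemma subspaceZ k u : X u -> X (k *: u).
Proof. by move=> Xu; have := sX.2 k u 0 Xu subspace0; rewrite addr0. Qed.

Lemma subspaceB u v : X u -> X v -> X (u - v).
Proof. by move=> Xu Xv; rewrite -scaleN1r; apply: subspaceD => //; exact: subspaceZ. Qed.

End subspace.

Section hilbert_theory.
Context {R : realType} {H : hilbert R}.
Local Notation C := R[i].
Local Notation dot := (hdot H).
Implicit Types (u v w : H) (K : set H).

Lemma dotDl u v w : dot (u + v) w = dot u w + dot v w.
Proof. exact: linearDl. Qed.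
Lemma dotDr u v w : dot u (v + w) = dot u v + dot u w.
Proof. exact: linearDr. Qed.
Lemma dotBl u v w : dot (u - v) w = dot u w - dot v w.
Proof. exact: linearBl. Qed.
Lemma dotBr u v w : dot u (v - w) = dot u v - dot u w.
Proof. exact: linearBr. Qed.
Lemma dotZl (k : C) v w : dot (k *: v) w = k * dot v w.
Proof. by rewrite linearZl_LR. Qed.
Lemma dotZr (k : C) v w : dot v (k *: w) = k^* * dot v w.
Proof. by rewrite linearZr_LR. Qed.
Lemma dotNl v w : dot (- v) w = - dot v w. Proof. exact: linearNl. Qed.
Lemma dot0l w : dot 0 w = 0. Proof. exact: linear0l. Qed.
Lemma dot0r w : dot w 0 = 0. Proof. exact: linear0r. Qed.
Lemma dotC v w : dot v w = (dot w v)^*.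
Proof. by rewrite {1}hermitian_subproof expr0 mul1r. Qed.

Lemma dotvv v : dot v v = (rnorm v ^+ 2)%:C.
Proof. by rewrite rmorphXn/= rnormE hdot_norm. Qed.

Lemma rnormD2 v w : rnorm (v + w) ^+ 2 = rnorm v ^+ 2 + 2 * Re (dot v w) + rnorm w ^+ 2.
Proof.
apply: complexI; rewrite -dotvv dotDl !dotDr !dotvv (dotC w v).
by apply: complex_eq; rewrite !(ReD, ImD, ReC, ImC, rmorphD, rmorphM)/=; ring.
Qed.

Lemma rnormB2 v w : rnorm (v - w) ^+ 2 = rnorm v ^+ 2 - 2 * Re (dot v w) + rnorm w ^+ 2.
Proof. by rewrite rnormD2 rnormN -scaleN1r dotZr rmorphN1 mulN1r ReN mulrN. Qed.

Lemma parallelogram v w :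
  rnorm (v + w) ^+ 2 + rnorm (v - w) ^+ 2 = 2 * rnorm v ^+ 2 + 2 * rnorm w ^+ 2.
Proof. by rewrite rnormD2 rnormB2; ring. Qed.

Lemma dot_le v w : rnorm (dot v w : C^o) <= rnorm v * rnorm w.
Proof.
have [->|w0] := eqVneq w 0; first by rewrite dot0r rnorm0 mulr_ge0 ?rnorm_ge0.
have wp : 0 < rnorm w ^+ 2.
  rewrite exprn_gt0// lt_def rnorm_ge0 andbT.
  by apply: contraNneq w0 => /rnorm_eq0 ->.
rewrite -(@ler_pXn2r _ 2)// ?nnegrE ?mulr_ge0 ?rnorm_ge0// exprMn -ler_pdivrMr//.
(* k w is the projection of v onto the line of w, the choice that minimizes |v - k w|. *)
pose k : C := ((rnorm w ^+ 2)^-1)%:C * dot v w.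
have := sqr_ge0 (rnorm (v - k *: w)); rewrite rnormB2 dotZr rnormZ exprMn.
rewrite /k rnormM rnorm_real rmorphM/= conj_real -mulrA ReMr.
have -> : Re ((dot v w)^* * dot v w) = rnorm (dot v w : C^o) ^+ 2.
  by rewrite rnormC2; case: (dot v w) => x y /=; ring.
rewrite ger0_norm ?invr_ge0 ?sqr_ge0// => h; rewrite -subr_ge0; move: h.
congr (0 <= _); have := lt0r_neq0 wp; move: (rnorm w ^+ 2) => N N0.
by rewrite exprMn; field.
Qed.

Section projection.
Variable K : set H.
Hypotheses (sK : subspace K) (cK : closed K).

Let half_sum v w : K v -> K w -> K ((2^-1 : R)%:C *: (v + w)).
Proof. by move=> *; apply/subspaceZ/subspaceD. Qed.

Lemma nearest_point x : exists2 k, K k & forall y, K y -> rnorm (x - k) <= rnorm (x - y).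
Proof.
pose S := [set rnorm (x - y) ^+ 2 | y in K]; pose d := inf S.
have hS : has_inf S.
  split; first by exists (rnorm (x - 0) ^+ 2); exists 0 => //; exact: subspace0.
  by exists 0 => _ [y _ <-]; exact: sqr_ge0.
have d_le y : K y -> d <= rnorm (x - y) ^+ 2.
  by move=> Ky; apply: ge_inf; [exact: hS.2|exists y].
have d0 : 0 <= d by apply: lb_le_inf; [exact: hS.1|move=> _ [y _ <-]; exact: sqr_ge0].
(* The defect is squared because the parallelogram law compares squares: midpoints stay in K, hence
   at squared distance at least d from x, and u is Cauchy at rate [hinv]. *)
have hk n : exists y, K y /\ rnorm (x - y) ^+ 2 < d + hinv n ^+ 2.
  have [|_ [y Ky <-] hy] := @inf_adherent _ S (hinv n ^+ 2) _ hS.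
    by rewrite exprn_gt0// hinv_gt0.
  by exists y.
pose u n := sval (cid (hk n)).
have [Ku du] : (forall n, K (u n)) /\ (forall n, rnorm (x - u n) ^+ 2 < d + hinv n ^+ 2).
  by split=> n; rewrite /u; case: cid => ? [].
have cauchy_u n m : rnorm (u n - u m) <= 2 * (hinv n + hinv m).
  have h0 := (ltW (hinv_gt0 (R := R) n), ltW (hinv_gt0 (R := R) m)).
  rewrite -(@ler_pXn2r _ 2)// ?nnegrE ?rnorm_ge0 ?mulr_ge0 ?addr_ge0 ?h0//.
  have := parallelogram (x - u n) (x - u m).
  have -> : x - u n - (x - u m) = u m - u n by rewrite opprB addrC subrKA.
  have -> : x - u n + (x - u m) = (2 : R)%:C *: (x - (2^-1 : R)%:C *: (u n + u m)).
    have e2 : (2 : R)%:C * (2^-1 : R)%:C = 1 by rewrite -[LHS]rmorphM mulfV ?pnatr_eq0.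
    rewrite scalerBr scalerA e2 scale1r rmorph_nat.
    rewrite scaler_nat mulr2n.
    by rewrite opprD addrACA.
  rewrite rnormZr exprMn (rnorm_distC (u m)) ger0_norm// => e.
  have := d_le _ (half_sum (Ku n) (Ku m)); have := du n; have := du m.
  have := mulr_ge0 h0.1 h0.2; move: e.
  set a := rnorm _ ^+ 2; set b := rnorm _ ^+ 2; set c1 := rnorm _ ^+ 2.
  set c2 := rnorm _ ^+ 2; move: (hinv n) (hinv m) => p q; nra.
have [k hk'] := complete_seq (ler0n _ 2) cauchy_u.
have Kk : K k.
  apply: closed_approx => // e e0; have [N hN] := hinv_small (ler0n R 2) e0.
  exists (u N) => //; rewrite rnorm_distC (le_lt_trans (hk' _))//; exact: hN.
exists k => // y Ky.
apply: (le_trans (y := Num.sqrt d)); last first.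
  by rewrite -(ger0_norm (rnorm_ge0 (x - y))) -sqrtr_sqr ler_wsqrtr// d_le.
(* 3 = 1 + 2: the excess of |x - u n| over the square root of d, and the distance from u n to k. *)
apply: (@le_hinv _ _ _ 3) => // n.
have un : rnorm (x - u n) <= Num.sqrt d + hinv n.
  rewrite -(@ler_pXn2r _ 2)// ?nnegrE ?rnorm_ge0 ?addr_ge0 ?sqrtr_ge0 ?(ltW (hinv_gt0 _))//.
  rewrite (le_trans (ltW (du n)))// sqrrD sqr_sqrtr// lerD2r lerDl.
  by rewrite mulrn_wge0// mulr_ge0 ?sqrtr_ge0 ?(ltW (hinv_gt0 _)).
rewrite -(subrKA (u n)) (le_trans (rnormD _ _))//.
by rewrite (le_trans (lerD un (hk' n)))//; move: (hinv n) => p; lra.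
Qed.

Lemma orthogonal_decomposition x : exists k, K k /\ forall y, K y -> dot (x - k) y = 0.
Proof.
have [k Kk hk] := nearest_point x; exists k; split=> // y Ky.
set c := dot _ y; apply: (@rnorm_eq0 _ C^o); set r := rnorm _.
(* Moving k by c y / N inside K would decrease the distance to x unless c = 0; the summand 1 covers
   y = 0. *)
pose N := 1 + rnorm y ^+ 2.
have N0 : 0 < N by rewrite ltr_pwDl ?sqr_ge0.
pose t : C := (N^-1)%:C * c.
have := hk (k + t *: y) (subspaceD sK Kk (subspaceZ sK t Ky)).
rewrite opprD addrA -(@ler_pXn2r _ 2)// ?nnegrE ?rnorm_ge0// (rnormB2 (x - k)).
rewrite dotZr rnormZ exprMn /t rnormM rnorm_real rmorphM/= conj_real -mulrA ReMr.
have -> : Re (c^* * c) = r ^+ 2.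
  by rewrite /r rnormC2; case: (c) => a b /=; ring.
rewrite ger0_norm ?invr_ge0 ?(ltW N0)// -/r -addrA lerDl.
have -> : - (2 * (N^-1 * r ^+ 2)) + (N^-1 * r) ^+ 2 * rnorm y ^+ 2
    = - (r ^+ 2 * (N + 1) / N ^+ 2).
  by rewrite (_ : rnorm y ^+ 2 = N - 1) /N; [field; rewrite -/N gt_eqF|ring].
have N1 : 0 < (N + 1) / N ^+ 2 by apply: divr_gt0; [exact: addr_gt0|exact: exprn_gt0].
rewrite oppr_ge0 -mulrA pmulr_lle0//.
by move=> h; apply/eqP; rewrite -sqrf_eq0 eq_le h sqr_ge0.
Qed.

End projection.

Definition oproj K x : H := xget 0 [set k | K k /\ forall y, K y -> dot (x - k) y = 0].

Section oproj.
Context {K : set H}.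
Hypotheses (sK : subspace K) (cK : closed K).
Local Notation P := (oproj K).

Lemma oprojP x : K (P x) /\ forall y, K y -> dot (x - P x) y = 0.
Proof.
rewrite /oproj; case: xgetP => [k -> //|].
by have [k hk] := orthogonal_decomposition sK cK x => /(_ k).
Qed.

Lemma oproj_dotl x y : K y -> dot (P x) y = dot x y.
Proof. by move=> /(oprojP x).2; rewrite dotBl => /subr0_eq. Qed.

Lemma oproj_dotr x y : K y -> dot y (P x) = dot y x.
Proof. by move=> Ky; rewrite dotC oproj_dotl// -dotC. Qed.

Lemma oproj_adj x y : dot (P x) y = dot x (P y).
Proof.
by rewrite -(oproj_dotr y (oprojP x).1) oproj_dotl//; exact: (oprojP y).1.
Qed.

Lemma oproj_uniq x k : K k -> (forall y, K y -> dot (x - k) y = 0) -> P x = k.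
Proof.
move=> Kk hk; apply/eqP; rewrite -subr_eq0; apply/eqP/rnorm_eq0/eqP.
rewrite -sqrf_eq0; apply/eqP/complexI; rewrite -dotvv dotBl.
have KPk : K (P x - k) by apply: subspaceB => //; exact: (oprojP x).1.
have := hk _ KPk; rewrite dotBl oproj_dotl// => ->//.
Qed.

Lemma oproj_id x : K x -> P x = x.
Proof. by move=> Kx; apply: oproj_uniq => // y _; rewrite subrr dot0l. Qed.

Lemma oproj_norm x : rnorm (P x) <= rnorm x.
Proof.
have [->|p0] := eqVneq (rnorm (P x)) 0; first exact: rnorm_ge0.
have pp : 0 < rnorm (P x) by rewrite lt_def p0 rnorm_ge0.
rewrite -(ler_pM2r pp) -expr2; have := dot_le x (P x).
by rewrite -(oproj_dotl x (oprojP x).1) dotvv rnorm_real ger0_norm ?sqr_ge0.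
Qed.

Lemma oproj_lin k x y : P (k *: x + y) = k *: P x + P y.
Proof.
have [[KPx ox] [KPy oy]] := (oprojP x, oprojP y).
apply: oproj_uniq => [|w Kw]; first exact: sK.2.
rewrite opprD addrACA -scalerBr dotDl dotZl ox// oy// mulr0 addr0//.
Qed.

Lemma oproj_orth0 x : (forall y, K y -> dot x y = 0) -> P x = 0.
Proof. by move=> h; apply: oproj_uniq; [exact: subspace0|rewrite subr0]. Qed.

End oproj.

Lemma riesz (f : H -> C) (M : R) :
    (forall (k : C) u v, f (k *: u + v) = k * f u + f v) ->
    (forall v, rnorm (f v : C^o) <= M * rnorm v) ->
  exists w, forall v, f v = dot v w.
Proof.
move=> lf bf; pose K := [set v | f v = 0].
have f0 : f 0 = 0 by have := lf (-1) 0 0; rewrite scaler0 add0r mulN1r addNr.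
have fZ k v : f (k *: v) = k * f v by have := lf k v 0; rewrite f0 !addr0.
have fB u v : f (u - v) = f u - f v.
  by have := lf (-1) v u; rewrite scaleN1r addrC mulN1r [RHS]addrC.
have sK : subspace K.
  by split=> // k u v; rewrite /K /= lf => -> ->; rewrite mulr0 addr0.
have cK : closed K.
  apply: approx_closed => v av; apply: (@rnorm_eq0 _ C^o); apply/eqP.
  rewrite eq_le rnorm_ge0 andbT; apply/ler_addgt0Pr => e e0; rewrite add0r.
  have M1 : 0 < 1 + `|M| by rewrite ltr_pwDl.
  have [w Kw vw] := av (e / (1 + `|M|)) (divr_gt0 e0 M1).
  have -> : f v = f (v - w) by rewrite fB Kw subr0.
  rewrite (le_trans (bf _))//; move: vw; rewrite ltr_pdivlMr// => /ltW/(le_trans _); apply.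
  by rewrite mulrC ler_wpM2l ?rnorm_ge0// (le_trans (ler_norm _))// lerDr.
have [f_0|[x fx]] : (forall v, f v = 0) \/ exists x, f x != 0.
- have [h|/existsNP[x /eqP fx]] := pselect (forall v, f v = 0); [by left|by right; exists x].
- by exists 0 => v; rewrite dot0r.
pose e := x - oproj K x; have [KP eP] := oprojP sK cK x.
have fe : f e = f x by rewrite fB KP subr0.
have e0 : dot e e != 0.
  rewrite dotvv; apply: contraNneq fx => /complexI/eqP; rewrite sqrf_eq0 => /eqP/rnorm_eq0.
  by rewrite -fe => ->; rewrite f0.
exists (((f e) / dot e e)^* *: e) => v; rewrite dotZr conjCK.
have Kv : K (f e *: v - f v *: e) by rewrite /K/= fB !fZ mulrC subrr.
have /(congr1 Num.conj) := eP _ Kv; rewrite -dotC rmorph0 dotBl !dotZl => /subr0_eq h.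
by rewrite mulrAC h mulfK.
Qed.

End hilbert_theory.

Lemma adjoint (R : realType) (H K : hilbert R) (T : H -> K) :
    (forall k u v, T (k *: u + v) = k *: T u + T v) ->
    (forall v, rnorm (T v) <= rnorm v) ->
  exists S : K -> H, forall v w, hdot K (T v) w = hdot H v (S w).
Proof.
move=> Tlin Tb; suff h w : exists s, forall v, hdot K (T v) w = hdot H v s.
  by exists (fun w => sval (cid (h w))) => v w; case: cid.
apply: (riesz (M := rnorm w)) => [k u v|v]; first by rewrite Tlin dotDl dotZl.
by rewrite (le_trans (dot_le _ _))// mulrC ler_wpM2l ?rnorm_ge0.
Qed.

(** * Discriminants, and additive functions of a real variable *)

Section real_lemmas.
Context {R : realType}.

(** The polynomial a - 2 b t + c t^2 is nonnegative; its value at the minimum t = b / c gives the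
    bound. For c = 0 it is affine, so that b = 0. *)
Lemma quadratic_bound (a b c : R) : 0 <= c ->
  (forall t, 2 * t * b <= a + t ^+ 2 * c) -> b ^+ 2 <= a * c.
Proof.
rewrite le_eqVlt => /orP[/eqP <- h|c0 h].
  have [->|b0] := eqVneq b 0; first by rewrite mulr0 expr0n.
  have := h ((a + 1) / (2 * b)); rewrite mulr0 addr0.
  have -> : 2 * ((a + 1) / (2 * b)) * b = a + 1 by field.
  by move=> h'; exfalso; lra.
have := h (b / c).
have -> : 2 * (b / c) * b = 2 * (b ^+ 2 / c) by field; exact: lt0r_neq0.
have -> : (b / c) ^+ 2 * c = b ^+ 2 / c by field; exact: lt0r_neq0.
move=> h'; have : b ^+ 2 / c <= a by lra.
by rewrite ler_pdivrMr.
Qed.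

(** h(t) = g(t) - t g(1) is additive and vanishes on integers, so its bound on [0, 1] holds
    everywhere; then |h(t)| = |h(n t)| / n tends to 0. This gives real homogeneity in the Jordan-von
    Neumann theorem. *)
Lemma additive_bounded_linear (g : R -> R) (K : R) :
    (forall s t, g (s + t) = g s + g t) ->
    (forall t, 0 <= t -> t <= 1 -> `|g t| <= K) ->
  forall t, g t = t * g 1.
Proof.
move=> gD gK; pose h t := g t - t * g 1.
have hD s t : h (s + t) = h s + h t by rewrite /h gD; ring.
have h0 : h 0 = 0 by have := hD 0 0; rewrite addr0 => e; lra.
have hN t : h (- t) = - h t.
  by apply/eqP; rewrite -subr_eq0 opprK -hD addNr h0.
have hn t n : h (t *+ n) = h t *+ n.
  by elim: n => [|n ih]; rewrite ?mulr0n// !mulrS hD ih.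
have h1 : h 1 = 0 by rewrite /h mul1r subrr.
have hz (k : int) : h k%:~R = 0.
  by case: k => n; rewrite ?NegzE ?mulrNz ?hN -?pmulrn hn h1 mul0rn ?oppr0.
have hb t : `|h t| <= K + `|g 1|.
  have /andP[lo hi] := floor_itv t.
  have -> : t = (Num.floor t)%:~R + (t - (Num.floor t)%:~R) by ring.
  rewrite hD hz add0r; set f := t - _.
  have [f0 f1] : 0 <= f /\ f <= 1.
    by move: lo hi; rewrite intrD /f; split; lra.
  rewrite /h (le_trans (ler_normB _ _))// lerD// ?gK// normrM ger0_norm//.
  by rewrite ler_piMl.
move=> t; apply/eqP; rewrite -subr_eq0 -normr_eq0 eq_le normr_ge0 andbT.
apply: (@le_hinv _ _ _ (K + `|g 1|)) => [|n]; first exact: le_trans (hb 0).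
rewrite add0r ler_pdivlMr// mulr_natr.
by rewrite -normrMn -/(h t) -hn hb.
Qed.

End real_lemmas.

(** * The Jordan-von Neumann theorem *)

Section jordan_von_neumann.
Context {R : realType} {V : normedModType R[i]}.
Hypothesis PL : forall v w : V,
  rnorm (v + w) ^+ 2 + rnorm (v - w) ^+ 2 = 2 * rnorm v ^+ 2 + 2 * rnorm w ^+ 2.
Local Notation N v := (rnorm v ^+ 2).
Implicit Types u v w : V.

Let r v w : R := (N (v + w) - N (v - w)) / 4.

Let rC v w : r v w = r w v.
Proof. by rewrite /r (addrC v w) (rnorm_distC v w). Qed.

Let r0 w : r 0 w = 0.
Proof. by rewrite /r add0r sub0r rnormN subrr mul0r. Qed.

Let r_sum_diff u v w : r (u + v) w + r (u - v) w = 2 * r u w.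
Proof.
have := PL (u + w) v; have := PL (u - w) v; rewrite /r.
rewrite (addrAC u w v) (addrAC u w (- v)) (addrAC u (- w) v) (addrAC u (- w) (- v)).
by move=> ? ?; lra.
Qed.

Let rD u v w : r (u + v) w = r u w + r v w.
Proof.
have r2 x : r (x + x) w = 2 * r x w.
  by have := r_sum_diff x x w; rewrite subrr r0 addr0.
(* The sum and the difference of u + v and u - v are 2 u and 2 v. *)
have := r_sum_diff (u + v) (u - v) w.
rewrite addrACA subrr addr0 opprB (addrC (u + v)) addrA subrK.
by rewrite !r2 => h; lra.
Qed.

Let rZ (t : R) u w : r (t%:C *: u) w = t * r u w.
Proof.
pose g (s : R) := r (s%:C *: u) w.
have -> : r u w = g 1 by rewrite /g rmorph1 scale1r.
apply: (@additive_bounded_linear _ g ((rnorm u + rnorm w) ^+ 2)) => [s s'|s s0 s1].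
  by rewrite /g rmorphD scalerDl rD.
have bound v : v = w \/ v = - w -> N (s%:C *: u + v) <= (rnorm u + rnorm w) ^+ 2.
  move=> hv; have vw : rnorm v = rnorm w by case: hv => ->; rewrite ?rnormN.
  rewrite ler_pXn2r ?nnegrE ?rnorm_ge0 ?addr_ge0 ?rnorm_ge0//.
  rewrite (le_trans (rnormD _ _))// vw lerD2r rnormZr ger0_norm//.
  by rewrite ler_piMl ?rnorm_ge0.
have := bound w (or_introl erefl); have := bound _ (or_intror erefl).
have := sqr_ge0 (rnorm (s%:C *: u + w)); have := sqr_ge0 (rnorm (s%:C *: u - w)).
by rewrite ler_norml /g /r => *; apply/andP; split; lra.
Qed.

Let rii u w : r ('i *: u) ('i *: w) = r u w.
Proof.
have iN v : rnorm ('i%R *: v) = rnorm v.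
  by rewrite rnormZ /rnorm normCi mul1r.
by rewrite /r -scalerDr -scalerBr !iN.
Qed.

Let rN u w : r (- u) w = - r u w.
Proof. by have := rD u (- u) w; rewrite subrr r0 => h; lra. Qed.

Let ri u w : r ('i *: u) w = - r u ('i *: w).
Proof.
have := rii ('i *: u) w; rewrite scalerA -expr2 sqrCi scaleN1r rN => <- //.
Qed.

Let rvv u : r u u = N u.
Proof.
rewrite /r subrr rnorm0 -mulr2n -scaler_nat -(rmorph_nat (real_complex R)) rnormZr.
by rewrite ger0_norm// exprMn; field.
Qed.

(** The imaginary part is forced: Im <v, w> = Re <v, i w> for a form that is conjugate-linear in its
    second variable. *)
Definition polar v w : R[i] := Complex (r v w) (r v ('i *: w)).

Lemma polar_herm v w : polar v w = (polar w v)^*.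
Proof.
apply: complex_eq; rewrite ?ReC ?ImC/=; first exact: rC.
by rewrite rC ri.
Qed.

Lemma polar_lin (k : R[i]) u v w : polar (k *: u + v) w = k * polar u w + polar v w.
Proof.
have kE : k *: u = (Re k)%:C *: u + (Im k)%:C *: ('i *: u).
  by rewrite scalerA -scalerDl {1}[k]complexE complexiE mulrC [in LHS]addrC addrC mulrC.
apply: complex_eq; rewrite ?ReD ?ImD kE/= !rD !rZ ?rii ?ri.
  by case: k {kE} => a b /=; ring.
by case: k {kE} => a b /=; ring.
Qed.

Lemma polarvv v : polar v v = (N v)%:C.
Proof.
apply: complex_eq => /=; first exact: rvv.
by have := ri v v; rewrite rC => h; lra.
Qed.

Let polar_linr u : GRing.linear_for (Num.conj \; *%R : R[i] -> R[i] -> R[i]) (polar u).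
Proof. by move=> k v w /=; rewrite !(polar_herm u) polar_lin rmorphD rmorphM. Qed.

Let polar_linl w : GRing.linear_for (@GRing.mul R[i]) (polar ^~ w).
Proof. by move=> k u v; exact: polar_lin. Qed.

Let polar_sym v w : polar v w = (-1) ^+ false * (polar w v)^*.
Proof. by rewrite expr0 mul1r -polar_herm. Qed.

Let polar_gt0 v : v != 0 -> 0 < polar v v.
Proof.
move=> v0; rewrite polarvv ltr0c exprn_gt0// lt_def rnorm_ge0 andbT.
by apply: contraNneq v0 => /rnorm_eq0 ->.
Qed.

Definition polar_dot : {dot V for (Num.conj : R[i] -> R[i])} :=
  HB.pack_for {dot V for (Num.conj : R[i] -> R[i])} polar
    (bilinear_isBilinear.Build R[i] V V R[i] *%R (Num.conj \; *%R) polar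
      (polar_linl, polar_linr))
    (isHermitianSesquilinear.Build R[i] V false Num.conj polar polar_sym)
    (isDotProduct.Build R[i] V polar polar_gt0).

End jordan_von_neumann.
(** * The Hilbert space of a semi-inner product *)

Record semidot (R : realType) (V : lmodType R[i]) := Semidot {
  sdot :> V -> V -> R[i] ;
  sdot_lin : forall k u v w, sdot (k *: u + v) w = k * sdot u w + sdot v w ;
  sdot_sym : forall v w, sdot v w = (sdot w v)^* ;
  sdot_ge0 : forall v, 0 <= Re (sdot v v)
}.

Section semidot_theory.
Context {R : realType} {V : lmodType R[i]} (D : semidot V).
Local Notation C := R[i].
Implicit Types u v w : V.

Definition snorm v : R := Num.sqrt (Re (D v v)).

Lemma snorm_ge0 v : 0 <= snorm v. Proof. exact: sqrtr_ge0. Qed.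

Lemma snorm2 v : snorm v ^+ 2 = Re (D v v).
Proof. by rewrite sqr_sqrtr// sdot_ge0. Qed.

Lemma sdotDl u v w : D (u + v) w = D u w + D v w.
Proof. by have := sdot_lin D 1 u v w; rewrite scale1r mul1r. Qed.

Lemma sdot0l w : D 0 w = 0.
Proof. by apply: (@addrI _ (D 0 w)); rewrite -sdotDl !addr0. Qed.

Lemma sdotZl k v w : D (k *: v) w = k * D v w.
Proof. by have := sdot_lin D k v 0 w; rewrite sdot0l !addr0. Qed.

Lemma sdotDr u v w : D u (v + w) = D u v + D u w.
Proof. by rewrite sdot_sym sdotDl rmorphD/= (sdot_sym D u v) (sdot_sym D u w). Qed.

Lemma sdotZr k v w : D v (k *: w) = k^* * D v w.
Proof. by rewrite sdot_sym sdotZl rmorphM/= (sdot_sym D v w). Qed.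

Lemma snorm2D v w : snorm (v + w) ^+ 2 = snorm v ^+ 2 + 2 * Re (D v w) + snorm w ^+ 2.
Proof.
rewrite !snorm2 sdotDl !sdotDr (sdot_sym D w v) !ReD ReC; ring.
Qed.

Lemma snorm2Z (t : R) v : snorm (t%:C *: v) ^+ 2 = t ^+ 2 * snorm v ^+ 2.
Proof. by rewrite !snorm2 sdotZl sdotZr conj_real !ReMr; ring. Qed.

Lemma snormZ k v : snorm (k *: v) = rnorm (k : C^o) * snorm v.
Proof.
rewrite /snorm sdotZl sdotZr mulrA.
have -> : k * k^* = (rnorm (k : C^o) ^+ 2)%:C.
  by rewrite rnormC2; case: k => a b; apply: complex_eq => /=; ring.
by rewrite ReMr sqrtrM ?sqr_ge0// sqrtr_sqr ger0_norm ?rnorm_ge0.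
Qed.

(** w may be a null vector, on which v cannot be projected. The discriminant of t |-> |v - t <v, w>
    w|^2 is used instead, and a factor |<v, w>|^2 is cancelled. *)
Lemma sdot_le v w : rnorm (D v w : C^o) <= snorm v * snorm w.
Proof.
have [->|c0] := eqVneq (rnorm (D v w : C^o)) 0.
  by rewrite mulr_ge0 ?snorm_ge0.
have cp : 0 < rnorm (D v w : C^o) ^+ 2.
  by rewrite exprn_gt0// lt_def c0 rnorm_ge0.
rewrite -(@ler_pXn2r _ 2)// ?nnegrE ?mulr_ge0 ?rnorm_ge0 ?snorm_ge0//.
rewrite -(ler_pM2r cp) exprMn.
suff : (rnorm (D v w : C^o) ^+ 2) ^+ 2
    <= snorm v ^+ 2 * (snorm w ^+ 2 * rnorm (D v w : C^o) ^+ 2).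
  by rewrite [leLHS]expr2 mulrA.
apply: quadratic_bound => [|t].
  by rewrite mulr_ge0 ?sqr_ge0.
have := sqr_ge0 (snorm (v + (- t)%:C *: (D v w *: w))).
rewrite snorm2D snorm2Z snormZ sdotZr conj_real ReMr sdotZr exprMn.
have -> : Re ((D v w)^* * D v w) = rnorm (D v w : C^o) ^+ 2.
  by rewrite rnormC2; case: (D v w) => a b /=; ring.
rewrite sqrrN => h; lra.
Qed.

End semidot_theory.

(** * Limits of scalar sequences, with rates *)

Section sequences.
Context {R : realType}.

(** The limit is the supremum of the lower bounds u n - c [hinv n], each of which is below every u m
    + c [hinv m]. *)
Lemma real_seq_limit (u : nat -> R) (c : R) :
    (forall n m, u n - u m <= c * (hinv n + hinv m)) ->
  exists l, forall n, `|u n - l| <= c * hinv n.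
Proof.
move=> hu; pose S := [set u n - c * hinv n | n in [set: nat]].
have ubS m : ubound S (u m + c * hinv m).
  by move=> _ [n _ <-]; have := hu n m; rewrite mulrDr => ?; lra.
have S0 : S !=set0 by exists (u 0%N - c * hinv 0%N); exists 0%N.
exists (sup S) => n; have h1 : u n - c * hinv n <= sup S.
  by apply: ub_le_sup; [exists (u 0%N + c * hinv 0%N); exact: ubS|exists n].
have h2 : sup S <= u n + c * hinv n by apply: ge_sup.
by rewrite ler_norml; apply/andP; split; lra.
Qed.

Lemma complex_seq_limit (u : nat -> R[i]) (c : R) :
    (forall n m, rnorm (u n - u m : R[i]^o) <= c * (hinv n + hinv m)) ->
  exists l, forall n, rnorm (u n - l : R[i]^o) <= 2 * c * hinv n.
Proof.
move=> hu.
have [n m|a ha] := @real_seq_limit (fun n => Re (u n)) c.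
  by rewrite -ReN -ReD (le_trans (Re_le_rnorm _)).
have [n m|b hb] := @real_seq_limit (fun n => Im (u n)) c.
  by rewrite -ImN -ImD (le_trans (Im_le_rnorm _)).
exists (Complex a b) => n; rewrite (le_trans (rnorm_le_ReIm _))//.
rewrite ReD ImD ReN ImN /=.
by have := ha n; have := hb n => ? ?; lra.
Qed.

End sequences.

(* The functionals on V that are conjugate-linear and bounded for the seminorm of
   D form a Hilbert space, to which V is mapped by [v |-> D v]: this replaces the
   completion of the quotient of V by its null vectors. *)
Section dual_space.
Context {R : realType} {V : lmodType R[i]}.
Variable D : semidot V.
Local Notation C := R[i].
Local Notation sn := (snorm D).

Definition dual_pred : {pred V -> C} := fun f =>
  `[< (forall k u v, f (k *: u + v) = k^* * f u + f v) /\
      exists M : R, forall v, rnorm (f v : C^o) <= M * sn v >].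

Lemma dual_predP f : f \in dual_pred ->
  (forall k u v, f (k *: u + v) = k^* * f u + f v) /\
  exists2 M : R, 0 <= M & forall v, rnorm (f v : C^o) <= M * sn v.
Proof.
move=> /asboolP[fl [M hM]]; split=> //; exists `|M| => // v.
by rewrite (le_trans (hM v))// ler_wpM2r ?snorm_ge0 ?ler_norm.
Qed.

Fact dual_pred_submod : submod_closed dual_pred.
Proof.
split=> [|a f1 f2 /dual_predP[l1 [M1 M10 h1]] /dual_predP[l2 [M2 M20 h2]]].
  apply/asboolP; split=> [k u v|]; first by rewrite /= mulr0 addr0.
  by exists 0 => v; rewrite rnorm0 mul0r.
apply/asboolP; split=> [k u v|].
  by rewrite !fctE l1 l2 /GRing.scale/=; ring.
exists (rnorm (a : C^o) * M1 + M2) => v.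
rewrite (le_trans (rnormD _ _))// mulrDl lerD//.
by rewrite rnormZ -mulrA ler_wpM2l ?rnorm_ge0.
Qed.

HB.instance Definition _ := GRing.isSubmodClosed.Build C (V -> C) dual_pred
  dual_pred_submod.

Record dual_space := DualSpace {
  dual_fun :> V -> C ;
  dual_funP : dual_fun \in dual_pred
}.

HB.instance Definition _ := [isSub for dual_fun].
HB.instance Definition _ := [Choice of dual_space by <:].
HB.instance Definition _ := [SubChoice_isSubLmodule of dual_space by <:].

Implicit Types (f g : dual_space) (u v w : V).

Lemma dualP f g : (forall v, f v = g v) -> f = g.
Proof. by move=> h; apply/val_inj/funext. Qed.

Lemma dualD f g v : (f + g) v = f v + g v. Proof. by []. Qed.
Lemma dualN f v : (- f) v = - f v. Proof. by []. Qed.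
Lemma dualZ k f v : (k *: f) v = k * f v. Proof. by []. Qed.

Lemma dual_lin f k u v : f (k *: u + v) = k^* * f u + f v.
Proof. exact: (dual_predP (dual_funP f)).1. Qed.

Lemma dual_funD f u v : f (u + v) = f u + f v.
Proof. by have := dual_lin f 1 u v; rewrite scale1r rmorph1 mul1r. Qed.

Lemma dual_fun0 f : f 0 = 0.
Proof. by apply: (@addrI _ (f 0)); rewrite -dual_funD !addr0. Qed.

Lemma dual_funZ f k v : f (k *: v) = k^* * f v.
Proof. by have := dual_lin f k v 0; rewrite dual_fun0 !addr0. Qed.

Definition dual_norm f : R :=
  best_constant (fun v => rnorm (f v : C^o)) (fun v => sn v).

Lemma dual_norm_ge0 f : 0 <= dual_norm f.
Proof. exact: best_constant_ge0. Qed.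

Lemma dual_normP f v : rnorm (f v : C^o) <= dual_norm f * sn v.
Proof.
have [_ [M M0 hM]] := dual_predP (dual_funP f).
exact: (@best_constantP _ _ (fun v => rnorm (f v : C^o)) (fun v => sn v) _ v M0
  (@snorm_ge0 _ _ D)).
Qed.

Lemma dual_norm_le f M : 0 <= M ->
  (forall v, rnorm (f v : C^o) <= M * sn v) -> dual_norm f <= M.
Proof. exact: best_constant_le. Qed.

Fact dual_normD f g : (dual_norm (f + g))%:C <= (dual_norm f)%:C + (dual_norm g)%:C.
Proof.
rewrite -rmorphD/= lecR; apply: dual_norm_le => [|v].
  by rewrite addr_ge0 ?dual_norm_ge0.
by rewrite dualD (le_trans (rnormD _ _))// mulrDl lerD ?dual_normP.
Qed.

Lemma dual_normZ_le (a : C) f : dual_norm (a *: f) <= rnorm (a : C^o) * dual_norm f.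
Proof.
apply: dual_norm_le => [|v]; first by rewrite mulr_ge0 ?rnorm_ge0 ?dual_norm_ge0.
by rewrite dualZ rnormM -mulrA ler_wpM2l ?rnorm_ge0 ?dual_normP.
Qed.

Fact dual_normZ (a : C) f : (dual_norm (a *: f))%:C = `|a| * (dual_norm f)%:C.
Proof.
rewrite -(@rnormE _ C^o) -rmorphM/=; congr (_%:C); apply/eqP.
rewrite eq_le dual_normZ_le/=.
have [->|a0] := eqVneq a 0; first by rewrite rnorm0 mul0r dual_norm_ge0.
have := dual_normZ_le a^-1 (a *: f); rewrite scalerA mulVf// scale1r => h.
rewrite (le_trans (ler_wpM2l (rnorm_ge0 _) h))// mulrA -rnormM divff//.
by rewrite /rnorm normr1/= mul1r.
Qed.

Fact dual_norm_eq0 f : (dual_norm f)%:C = 0 -> f = 0.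
Proof.
move=> /complexI f0; apply: dualP => v; apply: (@rnorm_eq0 _ C^o); apply/eqP.
by rewrite eq_le rnorm_ge0 andbT (le_trans (dual_normP _ _))// f0 mul0r.
Qed.

HB.instance Definition _ := Lmodule_isNormed.Build C dual_space
  dual_normD dual_normZ dual_norm_eq0.

Lemma dual_rnormE f : rnorm f = dual_norm f. Proof. by []. Qed.

Lemma dual_rnormP f v : rnorm (f v : C^o) <= rnorm f * sn v.
Proof. exact: dual_normP. Qed.

(* [`|f|^2] is the supremum of [2 Re f(v) - |v|^2]. *)
Lemma dual_norm2_le f (c : R) :
  (forall v, 2 * Re (f v) - sn v ^+ 2 <= c) -> rnorm f ^+ 2 <= c.
Proof.
move=> h; have c0 : 0 <= c.
  have := h 0; rewrite dual_fun0 snorm2 sdot0l/= mulr0 subr0; exact.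
rewrite -(sqr_sqrtr c0) ler_pXn2r ?nnegrE ?rnorm_ge0 ?sqrtr_ge0//.
apply: dual_norm_le => [|v]; first exact: sqrtr_ge0.
rewrite -(@ler_pXn2r _ 2)// ?nnegrE ?mulr_ge0 ?rnorm_ge0 ?sqrtr_ge0//.
rewrite exprMn sqr_sqrtr//; apply: quadratic_bound => [|t]; first exact: sqr_ge0.
(* For t <= 0 the left-hand side is not positive. For t > 0 the hypothesis is applied to t w^* v,
   where the unimodular w turns f(v) so as to reach its modulus. *)
have [t0|t0] := leP t 0.
  apply: (@le_trans _ _ 0); last by apply: addr_ge0 => //; apply: mulr_ge0; exact: sqr_ge0.
  by have := @rnorm_ge0 _ C^o (f v); nra.
rewrite mulrC -ler_pdivlMr ?mulr_gt0//; apply: rnorm_ge_Re => w w1.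
rewrite ler_pdivlMr ?mulr_gt0//.
have := h (t%:C *: (w^* *: v)).
rewrite dual_funZ conj_real dual_funZ conjCK ReMr snorm2Z snormZ rnormCj w1 mul1r.
by move=> ?; lra.
Qed.


Lemma dual_norm2_ge f v : 2 * Re (f v) - sn v ^+ 2 <= rnorm f ^+ 2.
Proof.
have := Re_le_rnorm (f v); have := dual_rnormP f v.
have := sqr_ge0 (rnorm f - sn v); rewrite sqrrB => *; lra.
Qed.

(** The norm is a supremum without a formula for an inner product, which therefore has to come from
    the Jordan-von Neumann theorem. Testing f1 at (v + w)/2 and f2 at (v - w)/2, the parallelogram
    law of D gives one inequality; applied to f + g and f - g, it gives the other. *)
Lemma dual_parallelogram f g :
  rnorm (f + g) ^+ 2 + rnorm (f - g) ^+ 2 = 2 * rnorm f ^+ 2 + 2 * rnorm g ^+ 2.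
Proof.
have le f1 f2 : rnorm (f1 + f2) ^+ 2 + rnorm (f1 - f2) ^+ 2
    <= 2 * rnorm f1 ^+ 2 + 2 * rnorm f2 ^+ 2.
  rewrite addrC -lerBrDr; apply: dual_norm2_le => w; rewrite lerBrDr addrC -lerBrDr.
  apply: dual_norm2_le => v; rewrite !dualD dualN !ReD ReN.
  have := dual_norm2_ge f1 ((2^-1 : R)%:C *: (v + w)).
  have := dual_norm2_ge f2 ((2^-1 : R)%:C *: (v - w)).
  rewrite !dual_funZ conj_real !ReMr !snorm2Z -(scaleN1r w) !dual_funD dual_funZ.
  rewrite rmorphN1 mulN1r !ReD ReN !snorm2D snormZ rnormN sdotZr rmorphN1 mulN1r ReN.
  rewrite {1}/rnorm normr1 mul1r.
  move=> *; lra.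
apply/eqP; rewrite eq_le le/=.
have twice (h : dual_space) : rnorm (h + h) ^+ 2 = 4 * rnorm h ^+ 2.
  have -> : h + h = (2 : R)%:C *: h by rewrite rmorph_nat scaler_nat mulr2n.
  by rewrite rnormZr ger0_norm// exprMn; ring.
have e1 : f + g + (f - g) = f + f by rewrite addrACA subrr addr0.
have e2 : f + g - (f - g) = g + g by rewrite opprB (addrC f g) addrACA subrr addr0.
have := le (f + g) (f - g); rewrite e1 e2 (twice f) (twice g).
move: (rnorm (f + g)) (rnorm (f - g)) => p q.
by move: (rnorm f) (rnorm g) => a b; clear => ?; lra.
Qed.

(** The centres u n of balls of radius [hinv n] that belong to F converge pointwise, with a rate
    proportional to the seminorm of the argument; hence the limit is bounded and the convergence
    holds in norm. *)
Fact dual_complete (F : set_system dual_space) : ProperFilter F -> cauchy F -> cvg F.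
Proof.
move=> FF /cauchyP Fc.
have hn n : exists h : dual_space, F [set f | rnorm (h - f) < hinv n].
  have [|h hF] := Fc (hinv n)%:C; first by rewrite ltr0c hinv_gt0.
  exists h; apply: filterS hF => f.
  by rewrite -ball_normE /ball_/= -rnormE ltcR.
pose u n := sval (cid (hn n)).
have hu n : F [set f | rnorm (u n - f) < hinv n] by rewrite /u; case: cid.
have uu n m v : rnorm (u n v - u m v : C^o) <= sn v * (hinv n + hinv m).
  have [f [fn fm]] := filter_ex (filterI (hu n) (hu m)).
  rewrite -[u n v - _]/((u n - u m) v) (le_trans (dual_rnormP _ _))//.
  rewrite mulrC ler_wpM2l ?snorm_ge0// -(subrKA f) (le_trans (rnormD _ _))//.
  by rewrite lerD// ltW// rnorm_distC.
have hl v : exists l : C, forall n, rnorm (u n v - l : C^o) <= 2 * sn v * hinv n.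
  by apply: complex_seq_limit => n m; exact: uu.
pose l v := sval (cid (hl v)).
have ul v n : rnorm (u n v - l v : C^o) <= 2 * sn v * hinv n by rewrite /l; case: cid.
have lP : l \in dual_pred.
  apply/asboolP; split=> [k v w|].
    apply/eqP; rewrite -subr_eq0; apply/eqP/(@rnorm_eq0 _ C^o)/eqP.
    rewrite eq_le rnorm_ge0 andbT.
    pose c := 2 * sn (k *: v + w) + rnorm (k : C^o) * (2 * sn v) + 2 * sn w.
    apply: (@le_hinv _ _ _ c) => [|n].
      by rewrite !addr_ge0 ?mulr_ge0 ?snorm_ge0 ?rnorm_ge0.
    have -> : l (k *: v + w) - (k^* * l v + l w) =
      - (u n (k *: v + w) - l (k *: v + w)) + (k^* * (u n v - l v) + (u n w - l w)).
      by rewrite dual_lin; ring.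
    rewrite add0r (le_trans (rnormD _ _))// rnormN /c 2!mulrDl -addrA lerD//.
    rewrite (le_trans (rnormD _ _))// lerD// rnormM rnormCj -mulrA.
    by rewrite ler_wpM2l ?rnorm_ge0.
  exists (rnorm (u 0%N) + 2) => v.
  rewrite -(subrKC (u 0%N v) (l v)) (le_trans (rnormD _ _))// mulrDl lerD//.
    exact: dual_rnormP.
  by rewrite (@rnorm_distC _ C^o) (le_trans (ul v 0%N))// /hinv invr1 mulr1.
pose f := DualSpace lP.
have uf n : rnorm (u n - f) <= 2 * hinv n.
  rewrite dual_rnormE; apply: dual_norm_le => [|v].
    by rewrite mulr_ge0 ?(ltW (hinv_gt0 _)).
  by rewrite dualD dualN (le_trans (ul v n))// mulrAC.
apply/cvg_ex; exists f => U /nbhs_rnormP[e e0 hU].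
(* 3 = 2 + 1: the distance from u N to f, and the radius of the ball around u N. *)
have [N hN] := hinv_small (ler0n R 3) e0.
apply: filterS (hu N) => g gN; apply: hU.
rewrite -(subrKA (u N)) (le_lt_trans (rnormD _ _))// rnorm_distC.
by have := hN N (leqnn _); have := uf N; move: gN => /= *; lra.
Qed.

HB.instance Definition _ := Uniform_isComplete.Build dual_space dual_complete.

Fact dual_vec_subproof v : (fun w => D v w) \in dual_pred.
Proof.
apply/asboolP; split=> [k u w|]; first by rewrite sdotDr sdotZr.
by exists (sn v) => w; exact: sdot_le.
Qed.

Definition dual_vec v : dual_space := DualSpace (dual_vec_subproof v).

Lemma dual_vec_lin k u v : dual_vec (k *: u + v) = k *: dual_vec u + dual_vec v.
Proof. by apply: dualP => w /=; rewrite sdot_lin. Qed.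

Lemma rnorm_dual_vec v : rnorm (dual_vec v) = sn v.
Proof.
apply/eqP; rewrite eq_le; apply/andP; split.
  by rewrite dual_rnormE; apply: dual_norm_le => [|w]; [exact: snorm_ge0|exact: sdot_le].
have [->|v0] := eqVneq (sn v) 0; first exact: rnorm_ge0.
have vp : 0 < sn v by rewrite lt_def v0 snorm_ge0.
rewrite -(ler_pM2r vp) -expr2 snorm2 (le_trans (Re_le_rnorm _))//.
exact: (dual_rnormP (dual_vec v)).
Qed.

Definition dual_dot := polar_dot dual_parallelogram.

Lemma dual_dot_norm f : dual_dot f f = `|f| ^+ 2.
Proof. by rewrite [LHS](polarvv dual_parallelogram) rmorphXn/= rnormE. Qed.

Definition dual_hilbert : hilbert R := Hilbert dual_dot_norm.

Lemma dual_hilbert_dot (f g : dual_hilbert) :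
  Re (hdot dual_hilbert f g) = (rnorm (f + g) ^+ 2 - rnorm (f - g) ^+ 2) / 4.
Proof. by []. Qed.

End dual_space.
(** * The GNS construction *)

Section gns.
Context {R : realType} {G : groupType} {V : lmodType R[i]}.
Variables (D : semidot V) (act : G -> V -> V).
Hypothesis act_lin : forall g k u v, act g (k *: u + v) = k *: act g u + act g v.
Hypothesis act1 : forall v, act 1%g v = v.
Hypothesis actM : forall g h v, act (g * h)%g v = act g (act h v).
Hypothesis act_iso : forall g v w, D (act g v) (act g w) = D v w.
Local Notation C := R[i].
Local Notation H := (dual_hilbert D).

Fact dual_act_subproof g (f : H) : (fun w => (f : dual_space D) (act (g^-1)%g w)) \in dual_pred D.
Proof.
apply/asboolP; split=> [k u w|]; first by rewrite act_lin dual_lin.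
exists (rnorm f) => w; rewrite (le_trans (dual_rnormP _ _))//.
by rewrite /snorm act_iso.
Qed.

(** The inverse makes this a left action, for which [gns_vec] is equivariant. *)
Definition dual_act g (f : H) : H := DualSpace (dual_act_subproof g f).

Fact dual_act_linear g : linear (dual_act g).
Proof. by move=> k f h; apply: dualP. Qed.

Definition dual_act_lin g : {linear H -> H} :=
  HB.pack_for {linear H -> H} (dual_act g)
    (GRing.isLinear.Build _ _ _ _ (dual_act g) (dual_act_linear g)).

Lemma dual_act_actM g h f : dual_act_lin (g * h)%g f = dual_act_lin g (dual_act_lin h f).
Proof. by apply: dualP => w /=; rewrite invgM actM. Qed.

Lemma dual_act_act1 f : dual_act_lin 1%g f = f.
Proof. by apply: dualP => w /=; rewrite invg1 act1. Qed.

Lemma dual_act_norm g f : rnorm (dual_act_lin g f) = rnorm f.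
Proof.
have le h u : rnorm (dual_act_lin h u) <= rnorm u.
  rewrite [leLHS]dual_rnormE; apply: dual_norm_le => [|v]; first exact: rnorm_ge0.
  rewrite /= (le_trans (dual_rnormP _ _))//.
  by rewrite /snorm act_iso.
apply/eqP; rewrite eq_le le/=.
by rewrite -{1}[f]dual_act_act1 -(mulVg g) dual_act_actM le.
Qed.

(** The inner product is defined from the norm by polarization, so that it is enough to preserve the
    norm. *)
Lemma dual_act_unitary g (f h : H) :
  hdot H (dual_act_lin g f) (dual_act_lin g h) = hdot H f h.
Proof.
have Re_eq (k : H) : Re (hdot H (dual_act_lin g f) (dual_act_lin g k)) = Re (hdot H f k).
  by rewrite !dual_hilbert_dot -linearD -linearB !dual_act_norm.
apply: complex_eq; first exact: Re_eq.
have ImE (u v : H) : Im (hdot H u v) = Re (hdot H u ('i *: v)).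
  by rewrite dotZr conjCi mulNr ReN ReMi opprK.
by rewrite !ImE -linearZ Re_eq.
Qed.

Definition gns_rep : unitary_rep R G :=
  @UnitaryRep R G H dual_act_lin dual_act_act1 dual_act_actM dual_act_unitary.

Definition gns_vec (v : V) : gns_rep := dual_vec D v.

Lemma gns_vec_lin k u v : gns_vec (k *: u + v) = k *: gns_vec u + gns_vec v.
Proof. exact: dual_vec_lin. Qed.

Lemma gns_vec_act g v : rep_act gns_rep g (gns_vec v) = gns_vec (act g v).
Proof.
apply: dualP => w; rewrite -[LHS]/(D v (act g^-1 w)%g).
by rewrite -[in RHS](act1 w) -(mulgV g) actM /= act_iso.
Qed.

Lemma gns_vec_dot u v : hdot gns_rep (gns_vec u) (gns_vec v) = D u v.
Proof.
have Re_eq w : Re (hdot gns_rep (gns_vec u) (gns_vec w)) = Re (D u w).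
  have eB : gns_vec u - gns_vec w = gns_vec (u + (-1) *: w).
    by rewrite addrC [in RHS]addrC gns_vec_lin scaleN1r.
  have eD : gns_vec u + gns_vec w = gns_vec (u + w).
    by have := gns_vec_lin 1 u w; rewrite !scale1r.
  rewrite [LHS]dual_hilbert_dot eB eD !rnorm_dual_vec !snorm2D snormZ rnormN.
  by rewrite {1}/rnorm normr1 mul1r sdotZr rmorphN1 mulN1r ReN; field.
apply: complex_eq; first exact: Re_eq.
have iE : 'i *: gns_vec v = gns_vec ('i *: v).
  have v0 : gns_vec 0 = 0 by apply: dualP => w /=; rewrite sdot0l.
  by have := gns_vec_lin 'i v 0; rewrite v0 !addr0.
have := Re_eq ('i *: v); rewrite -iE dotZr sdotZr conjCi !mulNr !ReN !ReMi !opprK.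
exact.
Qed.

End gns.

Section gns_pair.
Context {R : realType} {G : groupType} {U W : lmodType R[i]}.
Local Notation C := R[i].

(** GNS for the product of U and W, stated with functions of several variables so that its use on
    two copies of C[G] does not expose the product module. *)
Lemma gns_pair (f : U -> W -> U -> W -> C) (actU : G -> U -> U) (actW : G -> W -> W) :
    (forall k u w u' w' v z, f (k *: u + u') (k *: w + w') v z = k * f u w v z + f u' w' v z) ->
    (forall u w u' w', f u w u' w' = (f u' w' u w)^*) ->
    (forall u w, 0 <= Re (f u w u w)) ->
    (forall g k u u', actU g (k *: u + u') = k *: actU g u + actU g u') ->
    (forall g k w w', actW g (k *: w + w') = k *: actW g w + actW g w') ->
    (forall u, actU 1%g u = u) -> (forall w, actW 1%g w = w) ->
    (forall g h u, actU (g * h)%g u = actU g (actU h u)) ->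
    (forall g h w, actW (g * h)%g w = actW g (actW h w)) ->
    (forall g u w u' w', f (actU g u) (actW g w) (actU g u') (actW g w') = f u w u' w') ->
  exists (pi : unitary_rep R G) (e : U -> W -> pi),
    (forall u w u' w', hdot pi (e u w) (e u' w') = f u w u' w') /\
    (forall g u w, rep_act pi g (e u w) = e (actU g u) (actW g w)).
Proof.
move=> f_lin f_sym f_ge0 U_lin W_lin U1 W1 UM WM f_iso.
pose D : semidot (U * W)%type := @Semidot R (U * W)%type (fun p q => f p.1 p.2 q.1 q.2)
  (fun k p q r => f_lin k _ _ _ _ _ _) (fun p q => f_sym _ _ _ _) (fun p => f_ge0 _ _).
pose act g (p : U * W) := (actU g p.1, actW g p.2).
have act_lin g k p q : act g (k *: p + q) = k *: act g p + act g q.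
  by rewrite /act /= U_lin W_lin.
have act1 p : act 1%g p = p by rewrite /act U1 W1; case: p.
have actM g h p : act (g * h)%g p = act g (act h p) by rewrite /act UM WM.
have act_iso g p q : D (act g p) (act g q) = D p q by exact: f_iso.
exists (gns_rep act_lin act1 actM act_iso), (fun u w => gns_vec act_lin act1 actM act_iso (u, w)).
by split=> *; [rewrite gns_vec_dot|rewrite gns_vec_act].
Qed.

End gns_pair.

(** * Direct sums of unitary representations *)

Section direct_sum.
Context {R : realType} {G : groupType}.
Variables pi rho : unitary_rep R G.
Let V : lmodType R[i] := (pi * rho)%type.

Let dot (v w : V) : R[i] := hdot pi v.1 w.1 + hdot rho v.2 w.2.

Let dot_lin k u v w : dot (k *: u + v) w = k * dot u w + dot v w.
Proof. by rewrite /dot /= !dotDl !dotZl; ring. Qed.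

Let dot_sym v w : dot v w = (dot w v)^*.
Proof. by rewrite /dot rmorphD/= -!dotC. Qed.

Let dot_ge0 v : 0 <= Re (dot v v).
Proof. by rewrite /dot !dotvv ReD addr_ge0 ?sqr_ge0. Qed.

Definition sum_semidot : semidot V := Semidot dot_lin dot_sym dot_ge0.

Definition sum_act g (v : V) : V := (rep_act pi g v.1, rep_act rho g v.2).

Let act_lin g k u v : sum_act g (k *: u + v) = k *: sum_act g u + sum_act g v.
Proof. by rewrite /sum_act /= !linearP. Qed.

Let act1 v : sum_act 1%g v = v.
Proof. by case: v => a b; rewrite /sum_act !rep_act1. Qed.

Let actM g h v : sum_act (g * h)%g v = sum_act g (sum_act h v).
Proof. by rewrite /sum_act !rep_actM. Qed.

Let act_iso g v w : sum_semidot (sum_act g v) (sum_act g w) = sum_semidot v w.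
Proof. by rewrite /= /dot !rep_unitary. Qed.

(** GNS applied to the sum of the two inner products provides a complete space at once; the
    isometric equivariant embeddings with orthogonal ranges are all that is kept of the sum. *)
Lemma rep_sum : exists (sigma : unitary_rep R G) (i : pi -> sigma) (j : rho -> sigma),
  [/\ [/\ forall k u v, i (k *: u + v) = k *: i u + i v,
        forall u v, hdot sigma (i u) (i v) = hdot pi u v &
        forall g v, rep_act sigma g (i v) = i (rep_act pi g v)],
      [/\ forall k u v, j (k *: u + v) = k *: j u + j v,
        forall u v, hdot sigma (j u) (j v) = hdot rho u v &
        forall g v, rep_act sigma g (j v) = j (rep_act rho g v)] &
      forall u v, hdot sigma (i u) (j v) = 0].
Proof.
exists (gns_rep act_lin act1 actM act_iso).
exists (fun v => gns_vec act_lin act1 actM act_iso (v, 0)).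
exists (fun v => gns_vec act_lin act1 actM act_iso (0, v)).
split; [split| split|] => [k u v|u v|g v|k u v|u v|g v|u v].
- rewrite -gns_vec_lin; congr gns_vec; congr pair => /=.
  by rewrite scaler0 addr0.
- by rewrite gns_vec_dot /= /dot /= dot0l addr0.
- by rewrite gns_vec_act; congr gns_vec; rewrite /sum_act/= linear0.
- rewrite -gns_vec_lin; congr gns_vec; congr pair => /=.
  by rewrite scaler0 addr0.
- by rewrite gns_vec_dot /= /dot /= dot0l add0r.
- by rewrite gns_vec_act; congr gns_vec; rewrite /sum_act/= linear0.
- by rewrite gns_vec_dot /= /dot /= dot0l dot0r addr0.
Qed.

End direct_sum.

(** * Coefficients of unitary representations *)

Section coefficients.
Context {R : realType} {G : groupType}.
Local Notation C := R[i].
Local Notation BG := (fourier_stieltjes R G).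
Implicit Types pi : unitary_rep R G.

Lemma pairing_coef pi (v w : pi) x :
  pairing (fun g => hdot pi (rep_act pi g v) w) x = hdot pi (rep_ext x v) w.
Proof.
rewrite /pairing /rep_ext /cg_ext linear_sumlz; apply: eq_bigr => g _.
by rewrite linearZl_LR mulrC.
Qed.

Fact coef_subproof pi (v w : pi) : (fun g => hdot pi (rep_act pi g v) w) \in @fs_pred R G.
Proof.
apply/asboolP; exists (rnorm v * rnorm w) => x; rewrite pairing_coef.
rewrite (le_trans (dot_le _ _))// mulrAC ler_wpM2r ?rnorm_ge0//.
by rewrite mulrC cstar_normP.
Qed.

Definition coef pi (v w : pi) : BG := FourierStieltjes (coef_subproof v w).

Lemma fs_norm_coef pi (v w : pi) : fs_norm (coef v w) <= rnorm v * rnorm w.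
Proof.
apply: fs_norm_le => [|x]; first by rewrite mulr_ge0 ?rnorm_ge0.
rewrite pairing_coef (le_trans (dot_le _ _))// mulrAC ler_wpM2r ?rnorm_ge0//.
by rewrite mulrC cstar_normP.
Qed.

Lemma coef_linl pi k (u v w : pi) : coef (k *: u + v) w = k *: coef u w + coef v w.
Proof. by apply: fsP => g /=; rewrite linearP dotDl dotZl. Qed.

Lemma coef_linr pi k (u v w : pi) : coef w (k *: u + v) = k^* *: coef w u + coef w v.
Proof. by apply: fsP => g /=; rewrite dotDr dotZr. Qed.

Lemma rep_act_adj pi g (v w : pi) : hdot pi (rep_act pi g v) w = hdot pi v (rep_act pi (g^-1)%g w).
Proof. by rewrite -[in RHS](rep_unitary g) -rep_actM mulgV rep_act1. Qed.

Lemma rtrans_coef pi g (v w : pi) : rtrans (coef v w) g = coef v (rep_act pi (g^-1)%g w).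
Proof. by apply: fsP => h /=; rewrite rep_actM rep_act_adj. Qed.

Lemma ltrans_coef pi g (v w : pi) : ltrans g (coef v w) = coef (rep_act pi g v) w.
Proof. by apply: fsP => h /=; rewrite rep_actM. Qed.

Lemma fs_star_coef pi (v w : pi) : fs_star (coef v w) = coef w v.
Proof. by apply: fsP => g /=; rewrite -dotC rep_act_adj. Qed.

End coefficients.
(** * The Hahn-Banach theorem *)

Section sublinear.
Context {R : realType} {V : lmodType R[i]}.
Implicit Types (q f : V -> R) (u v w : V).

(** An inequality is enough in the second clause: using it for t and for its inverse yields
    equality, as in [sublinearZ]. *)
Definition sublinear q := (forall u v, q (u + v) <= q u + q v) /\
  (forall t v, 0 < t -> q (t%:C *: v) <= t * q v).

Lemma sublinear0 q : sublinear q -> q 0 = 0.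
Proof.
move=> [qD qZ]; have := qD 0 0; have := qZ 2^-1 0.
by rewrite scaler0 addr0 invr_gt0 ltr0n => /(_ isT) *; lra.
Qed.

Lemma sublinearZ q t v : sublinear q -> 0 <= t -> q (t%:C *: v) = t * q v.
Proof.
move=> sq; rewrite le_eqVlt => /orP[/eqP <-|t0].
  by rewrite scale0r sublinear0// mul0r.
apply/eqP; rewrite eq_le sq.2//= -ler_pdivlMl//.
have e : v = (t^-1)%:C *: (t%:C *: v).
  by rewrite scalerA -[_ * _]rmorphM/= mulVf ?gt_eqF// scale1r.
by rewrite {1}e sq.2// invr_gt0.
Qed.

Lemma sublinear_ge q v : sublinear q -> - q (- v) <= q v.
Proof. by move=> sq; have := sq.1 v (- v); rewrite subrr sublinear0// => *; lra. Qed.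

Lemma inf_sublinear (S : V -> set R) :
    (forall v, S v !=set0) -> (forall v, has_lbound (S v)) ->
    (forall u v a b, S u a -> S v b -> exists2 c, S (u + v) c & c <= a + b) ->
    (forall t v a, 0 < t -> S v a -> exists2 c, S (t%:C *: v) c & c <= t * a) ->
  sublinear (fun v => inf (S v)).
Proof.
move=> S0 Sb SD SZ; split=> [u v|t v t0].
  rewrite -lerBlDr; apply: lb_le_inf => // a Sa; rewrite lerBlDr -lerBlDl.
  apply: lb_le_inf => // b Sb'; rewrite lerBlDl.
  by have [c Sc] := SD _ _ _ _ Sa Sb'; apply: le_trans; exact: ge_inf.
rewrite -ler_pdivrMl//; apply: lb_le_inf => // a Sa; rewrite ler_pdivrMl//.
by have [c Sc] := SZ _ _ _ t0 Sa; apply: le_trans; exact: ge_inf.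
Qed.

(** Minimality forces f to be odd, and subadditivity applied to u = (u + v) + (- v) then gives the
    reverse inequality. *)
Lemma minimal_sublinear_linear f : sublinear f ->
    (forall g, sublinear g -> (forall v, g v <= f v) -> g = f) ->
  (forall u v, f (u + v) = f u + f v) /\ (forall t v, f (t%:C *: v) = t * f v).
Proof.
move=> sf minf.
(* [f] is not decreased by [u |-> inf_(t >= 0) f(u + t v) - t f(v)]. *)
have odd v : f (- v) <= - f v.
  pose S u := [set f (u + t%:C *: v) - t * f v | t in [set t | 0 <= t]].
  have Sb u : lbound (S u) (- f (- u)).
    move=> _ [t t0 <-]; have := sf.1 (u + t%:C *: v) (- u).
    by rewrite addrAC subrr add0r (sublinearZ v sf t0) => *; lra.
  have sS : sublinear (fun u => inf (S u)).
    apply: inf_sublinear => [u|u|u w _ _ [s s0 <-] [t t0 <-]|r u _ r0 [t t0 <-]].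
    - by exists (f (u + 0%:C *: v) - 0 * f v); exists 0 => //=.
    - by exists (- f (- u)); exact: Sb.
    - exists (f (u + w + (s + t)%:C *: v) - (s + t) * f v).
        by exists (s + t) => //=; exact: addr_ge0.
      rewrite rmorphD scalerDl addrACA.
      by have := sf.1 (u + s%:C *: v) (w + t%:C *: v) => *; lra.
    - exists (f (r%:C *: u + (r * t)%:C *: v) - (r * t) * f v).
        by exists (r * t) => //=; apply: mulr_ge0 => //; exact: ltW.
      rewrite rmorphM -scalerA -scalerDr (sublinearZ _ sf (ltW r0)).
      by rewrite mulrBr mulrA.
  have le u : inf (S u) <= f u.
    apply: ge_inf; first by exists (- f (- u)); exact: Sb.
    by exists 0 => //=; rewrite scale0r addr0 mul0r subr0.
  have -> : - f v = f (- v + 1%:C *: v) - 1 * f v.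
    by rewrite rmorph1 scale1r addNr sublinear0// mul1r sub0r.
  have /(congr1 (@^~ (- v))) <- := minf _ sS le.
  by apply: ge_inf; [exists (- f (- - v)); exact: Sb|exists 1 => //=].
have fN v : f (- v) = - f v.
  by apply/eqP; rewrite eq_le odd/= -lerNl sublinear_ge.
split=> [u v|t v].
  apply/eqP; rewrite eq_le sf.1/=.
  by have := sf.1 (u + v) (- v); rewrite addrK fN => *; lra.
have [t0|t0] := leP 0 t; first exact: sublinearZ.
have := sublinearZ v sf (ltW (_ : 0 < - t)); rewrite oppr_gt0 => /(_ t0).
by rewrite rmorphN scaleNr fN mulNr => /oppr_inj.
Qed.

Lemma sublinear_minorant q : sublinear q -> exists F : V -> R,
  [/\ forall u v, F (u + v) = F u + F v, forall t v, F (t%:C *: v) = t * F v &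
      forall v, F v <= q v].
Proof.
move=> sq.
pose T := {f : V -> R | sublinear f /\ forall v, f v <= q v}.
(* The order is reversed, so that a maximal element is a minimal sublinear function. *)
pose le (f g : T) := `[< forall v, sval g v <= sval f v >].
have [||||[f [sf fq]] fmin] := @Zorn T le.
- by move=> f; apply/asboolP.
- move=> f g h /asboolP fg /asboolP gh; apply/asboolP => v.
  exact: le_trans (gh v) (fg v).
- move=> [f hf] [g hg] /asboolP fg /asboolP gf.
  have e : f = g by apply/funext => v; apply/eqP; rewrite eq_le fg gf.
  by move: hf hg fg gf; rewrite e => hf hg _ _; congr exist; exact: Prop_irrelevance.
(* The empty chain is bounded by q itself, and a nonempty one by its pointwise infimum, which is
   finite because f <= q implies f(v) >= - q(- v). *)
- move=> A totA; have [[f0 Af0]|A0] := pselect (A !=set0); last first.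
    have hq : sublinear q /\ forall v, q v <= q v by [].
    by exists (exist _ q hq) => s As; exfalso; apply: A0; exists s.
  pose S v := [set sval f v | f in A].
  have Sb v : lbound (S v) (- q (- v)).
    move=> _ [[f [sf fq]] Af <-] /=; rewrite (le_trans _ (sublinear_ge v sf))//.
    by rewrite lerN2.
  have Shl v : has_lbound (S v) by exists (- q (- v)); exact: Sb.
  have sS : sublinear (fun v => inf (S v)).
    apply: inf_sublinear => [v||u v _ _ [f Af <-] [g Ag <-]|t v _ t0 [f Af <-]] //.
    - by exists (sval f0 v); exists f0.
    - have [/asboolP fg|/asboolP gf] := totA f g Af Ag.
        exists (sval g (u + v)); first by exists g.
        by rewrite (le_trans ((svalP g).1.1 u v))// lerD2r.
      exists (sval f (u + v)); first by exists f.
      by rewrite (le_trans ((svalP f).1.1 u v))// lerD2l.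
    - exists (sval f (t%:C *: v)); first by exists f.
      exact: (svalP f).1.2.
  have Sq v : inf (S v) <= q v.
    by apply: (le_trans _ ((svalP f0).2 v)); apply: ge_inf => //; exists f0.
  exists (exist (fun f => sublinear f /\ forall v, f v <= q v) _ (conj sS Sq)) => f Af; apply/asboolP => v /=.
  by apply: ge_inf => //; exists f.
exists f; have [] := minimal_sublinear_linear sf _; last by [].
move=> g sg gf; have gq v : g v <= q v by apply: le_trans (fq v); exact: gf.
have := fmin (exist (fun f => sublinear f /\ forall v, f v <= q v) g (conj sg gq)).
by move=> /(_ (introT (asboolP _) gf))/(congr1 sval).
Qed.

End sublinear.

(* The product module is hidden behind functions of two variables: with
   [U = W = C[G]], conversion problems on U * W unfold the operations of C[G]. *)
Section two_variables.
Context {R : realType} {U W : lmodType R[i]}.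
Implicit Types (u : U) (w : W).

(** Each element of [S u w] is an upper bound required of F at (u, w). Their infimum is sublinear
    and a real-linear minorant of it meets all the requirements: an extension problem becomes a
    choice of S. *)
Lemma inf_sublinear_minorant (S : U -> W -> set R) :
    (forall u w, S u w !=set0) -> (forall u w, has_lbound (S u w)) ->
    (forall u w u' w' a b, S u w a -> S u' w' b ->
      exists2 c, S (u + u') (w + w') c & c <= a + b) ->
    (forall t u w a, 0 < t -> S u w a ->
      exists2 c, S (t%:C *: u) (t%:C *: w) c & c <= t * a) ->
  exists F : U -> W -> R,
    [/\ forall u w u' w', F (u + u') (w + w') = F u w + F u' w',
        forall t u w, F (t%:C *: u) (t%:C *: w) = t * F u w &
        forall u w a, S u w a -> F u w <= a].
Proof.
move=> S0 Sb SD SZ.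
have [|F [FD FZ FS]] := @sublinear_minorant R (U * W)%type (fun p => inf (S p.1 p.2)).
  apply: inf_sublinear => [p|p|p q a b|t p a] //; [exact: SD|exact: SZ].
exists (fun u w => F (u, w)); split=> [u w u' w'|t u w|u w a Sa].
- exact: (FD (u, w) (u', w')).
- exact: (FZ t (u, w)).
- by rewrite (le_trans (FS (u, w)))//; exact: ge_inf.
Qed.

Variable F : U -> W -> R.
Hypotheses (FD : forall u w u' w', F (u + u') (w + w') = F u w + F u' w')
  (FZ : forall t u w, F (t%:C *: u) (t%:C *: w) = t * F u w).

Lemma real_linear2_N u w : F (- u) (- w) = - F u w.
Proof.
have F0 : F 0 0 = 0 by have := FZ 0 0 0; rewrite !scaler0 mul0r.
by apply/eqP; rewrite -subr_eq0 opprK -FD !addNr F0.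
Qed.

Lemma real_linear2_B u w u' w' : F (u - u') (w - w') = F u w - F u' w'.
Proof. by rewrite FD real_linear2_N. Qed.

(** The only complex-linear functional with real part F. *)
Definition complexify u w : R[i] := Complex (F u w) (- F ('i *: u) ('i *: w)).

Lemma complexify_lin k u w u' w' :
  complexify (k *: u + u') (k *: w + w') = k * complexify u w + complexify u' w'.
Proof.
have kE (V : lmodType R[i]) (v : V) : k *: v = (Re k)%:C *: v + (Im k)%:C *: ('i *: v).
  by rewrite scalerA -scalerDl {1}[k]complexE complexiE (mulrC _ 'i).
have ii (V : lmodType R[i]) (v : V) : 'i *: ('i *: v) = - v.
  by rewrite scalerA -expr2 sqrCi scaleN1r.
have Fk v z : F (k *: v) (k *: z) = Re k * F v z + Im k * F ('i *: v) ('i *: z).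
  by rewrite kE [k *: z]kE FD !FZ.
have ki (V : lmodType R[i]) (v : V) : 'i *: (k *: v) = k *: ('i *: v).
  by rewrite 2!scalerA mulrC.
apply: complex_eq; rewrite ?ReD ?ImD /= ?scalerDr FD.
  by rewrite Fk; case: (k) => x y /=; ring.
by rewrite !ki Fk !ii real_linear2_N; case: (k) => x y /=; ring.
Qed.

End two_variables.
(** * The group algebra *)

Section group_algebra.
Context {R : realType} {G : groupType}.
Local Notation C := R[i].
Local Notation CG := {malg C[G]}.
Implicit Types (x y z : CG) (g h : G) (k : C).

Lemma cg_extZ (V : lmodType C) (L : G -> V) k x : cg_ext L (k *: x) = k *: cg_ext L x.
Proof.
rewrite (cg_extw _ (msuppZ_le k x)) scaler_sumr; apply: eq_bigr => g _.
by rewrite mcoeffZ scalerA.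
Qed.

Lemma cg_ext_lin (V : lmodType C) (L : G -> V) k x y :
  cg_ext L (k *: x + y) = k *: cg_ext L x + cg_ext L y.
Proof. by rewrite cg_extD cg_extZ. Qed.

Lemma cg_ext_linL (V : lmodType C) (L1 L2 : G -> V) k x :
  cg_ext (fun g => k *: L1 g + L2 g) x = k *: cg_ext L1 x + cg_ext L2 x.
Proof.
rewrite /cg_ext scaler_sumr -big_split; apply: eq_bigr => g _ /=.
by rewrite scalerDr !scalerA mulrC.
Qed.

Lemma eq_cg_ext (V : lmodType C) (L1 L2 : G -> V) x : L1 =1 L2 -> cg_ext L1 x = cg_ext L2 x.
Proof. by move=> e; apply: eq_bigr => g _; rewrite e. Qed.

Lemma scale_delta k c g : k *: delta c g = delta (k * c) g :> CG.
Proof. by apply/malgP => h; rewrite mcoeffZ !mcoeffU mulrnAr. Qed.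

Lemma cg_ext_delta x : cg_ext (fun g => delta 1 g) x = x.
Proof.
rewrite [RHS]monalgE; apply: eq_bigr => g _.
by rewrite scale_delta mulr1.
Qed.

Lemma cg_mulE x y : cg_mul x y = cg_ext (fun g => cg_ext (fun h => delta 1 (g * h)%g) y) x.
Proof.
rewrite /cg_mul /cg_ext; apply: eq_bigr => g _; rewrite scaler_sumr.
by apply: eq_bigr => h _; rewrite scalerA scale_delta mulr1.
Qed.

Lemma cg_mul_linl k x y z : cg_mul (k *: x + y) z = k *: cg_mul x z + cg_mul y z.
Proof. by rewrite !cg_mulE cg_ext_lin. Qed.

Lemma cg_mul_linr k x y z : cg_mul z (k *: x + y) = k *: cg_mul z x + cg_mul z y.
Proof.
by rewrite !cg_mulE -[RHS]cg_ext_linL; apply: eq_cg_ext => g; rewrite cg_ext_lin.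
Qed.

Lemma cg_mul_delta (a b : C) g h : cg_mul (delta a g) (delta b h) = delta (a * b) (g * h)%g.
Proof. by rewrite cg_mulE !cg_extU !scale_delta !mulr1. Qed.

Lemma cg_mul1 x : cg_mul (delta 1 1%g) x = x.
Proof.
rewrite cg_mulE cg_extU scale1r -[RHS]cg_ext_delta.
by apply: eq_cg_ext => g; rewrite mul1g.
Qed.

Lemma cg_mulA x y z : cg_mul x (cg_mul y z) = cg_mul (cg_mul x y) z.
Proof.
rewrite -[LHS]cg_ext_delta -[RHS]cg_ext_delta [LHS]cg_ext_mul 2![RHS]cg_ext_mul.
apply: eq_cg_ext => g; rewrite cg_ext_mul; apply: eq_cg_ext => h.
by apply: eq_cg_ext => k; rewrite mulgA.
Qed.

Lemma cg_mul0l x : cg_mul 0 x = 0.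
Proof. by rewrite /cg_mul msupp0 big_seq_fset0. Qed.

Lemma cg_mul0r x : cg_mul x 0 = 0.
Proof. by rewrite /cg_mul big1// => g _; rewrite msupp0 big_seq_fset0. Qed.

Lemma cg_mul_suml (I : Type) (s : seq I) (F : I -> CG) y :
  cg_mul (\sum_(i <- s) F i) y = \sum_(i <- s) cg_mul (F i) y.
Proof. by rewrite cg_mulE cg_ext_sum; apply: eq_bigr => i _; rewrite cg_mulE. Qed.

Lemma cg_mul_sumr (I : Type) (s : seq I) (F : I -> CG) y :
  cg_mul y (\sum_(i <- s) F i) = \sum_(i <- s) cg_mul y (F i).
Proof.
elim: s => [|i s ih]; first by rewrite !big_nil cg_mul0r.
by rewrite !big_cons -ih -[F i]scale1r cg_mul_linr !scale1r.
Qed.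

Lemma cg_starw x (d : {fset G}) : fsubset (msupp x) d ->
  cg_star x = \sum_(g <- d) delta (x@_g)^* (g^-1)%g.
Proof.
move=> sd; rewrite /cg_star (big_fset_incl _ sd)//= => g _ gx.
by rewrite (mcoeff_outdom gx) rmorph0 monalgU0.
Qed.

Lemma cg_star_lin k x y : cg_star (k *: x + y) = k^* *: cg_star x + cg_star y.
Proof.
pose d := (msupp x `|` msupp y)%fset.
have sx : fsubset (msupp x) d by exact: fsubsetUl.
have sy : fsubset (msupp y) d by exact: fsubsetUr.
have skxy : fsubset (msupp (k *: x + y)) d.
  apply: fsubset_trans (msuppD_le _ _) _; apply: fsetSU; exact: msuppZ_le.
rewrite (cg_starw sx) (cg_starw sy) (cg_starw skxy) scaler_sumr -big_split/=.
apply: eq_bigr => g _.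
by rewrite mcoeffD mcoeffZ rmorphD rmorphM/= monalgUD scale_delta.
Qed.

Lemma cg_star_delta (c : C) g : cg_star (delta c g) = delta c^* (g^-1)%g.
Proof. by rewrite (cg_starw msuppU_le) big_seq_fset1 mcoeffUU. Qed.

Lemma cg_star0 : cg_star 0 = 0 :> CG.
Proof. by rewrite /cg_star msupp0 big_seq_fset0. Qed.

Lemma cg_starZ k x : cg_star (k *: x) = k^* *: cg_star x.
Proof. by rewrite -[k *: x]addr0 cg_star_lin cg_star0 addr0. Qed.

Lemma cg_star_sum (I : Type) (s : seq I) (F : I -> CG) :
  cg_star (\sum_(i <- s) F i) = \sum_(i <- s) cg_star (F i).
Proof.
elim: s => [|i s ih]; first by rewrite !big_nil cg_star0.
by rewrite !big_cons -ih -[F i]scale1r cg_star_lin rmorph1 !scale1r.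
Qed.

Lemma cg_starM x y : cg_star (cg_mul x y) = cg_mul (cg_star y) (cg_star x).
Proof.
pose star z := \sum_(g <- msupp z) delta (z@_g)^* (g^-1)%g : CG.
rewrite -[cg_star x]/(star x) -[cg_star y]/(star y) cg_mul_suml.
under [RHS]eq_bigr do rewrite cg_mul_sumr.
rewrite exchange_big /cg_mul cg_star_sum; apply: eq_bigr => g _.
rewrite cg_star_sum; apply: eq_bigr => h _.
by rewrite cg_star_delta -/(cg_mul _ _) cg_mul_delta rmorphM invgM mulrC.
Qed.

Lemma cg_starK x : cg_star (cg_star x) = x.
Proof.
have -> : cg_star x = \sum_(g <- msupp x) delta (x@_g)^* (g^-1)%g by [].
rewrite cg_star_sum [RHS]monalgE; apply: eq_bigr => g _.
by rewrite cg_star_delta conjCK invgK.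
Qed.

Lemma pairingDr (f : G -> C) x y : pairing f (x + y) = pairing f x + pairing f y.
Proof. by rewrite !pairingE cg_extD. Qed.

Lemma pairingZr (f : G -> C) k x : pairing f (k *: x) = k * pairing f x.
Proof. by rewrite !pairingE cg_extZ. Qed.

Lemma rep_extD (pi : unitary_rep R G) x y (v : pi) :
  rep_ext (x + y) v = rep_ext x v + rep_ext y v.
Proof. exact: cg_extD. Qed.

Lemma rep_extZ (pi : unitary_rep R G) k x (v : pi) : rep_ext (k *: x) v = k *: rep_ext x v.
Proof. exact: cg_extZ. Qed.

Lemma rep_extB (pi : unitary_rep R G) x y (v : pi) :
  rep_ext (x - y) v = rep_ext x v - rep_ext y v.
Proof. by rewrite rep_extD -[in LHS](scaleN1r y) rep_extZ scaleN1r. Qed.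

Lemma rep_extZv (pi : unitary_rep R G) k x (v : pi) : rep_ext x (k *: v) = k *: rep_ext x v.
Proof.
rewrite /rep_ext /cg_ext scaler_sumr; apply: eq_bigr => g _.
by rewrite linearZ !scalerA mulrC.
Qed.

Lemma rep_extNv (pi : unitary_rep R G) x (v : pi) : rep_ext x (- v) = - rep_ext x v.
Proof.
rewrite /rep_ext /cg_ext -sumrN; apply: eq_bigr => g _.
by rewrite linearN scalerN.
Qed.

Lemma rep_ext0 (pi : unitary_rep R G) (v : pi) : rep_ext 0 v = 0.
Proof. exact: cg_ext0. Qed.

End group_algebra.
(** * Elements of B(G) as coefficients of unitary representations *)

Section representation.
Context {R : realType} {G : groupType}.
Local Notation C := R[i].
Local Notation CG := {malg C[G]}.
Local Notation BG := (fourier_stieltjes R G).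
Implicit Types (a b x y : CG) (pi : unitary_rep R G).

Lemma Re_dot_le pi (v w : pi) x : rnorm v <= 1 -> rnorm w <= 1 ->
  Re (hdot pi (rep_ext x v) w) <= cstar_norm x.
Proof.
move=> v1 w1; rewrite (le_trans (Re_le_rnorm _))// (le_trans (dot_le _ _))//.
rewrite -[leRHS]mulr1 ler_pM ?rnorm_ge0// (le_trans (cstar_normP _ _))//.
by rewrite ler_piMr ?cstar_norm_ge0.
Qed.

(** The unit vectors v / |v| and pi(x) v / |pi(x) v| have pairing |pi(x) v| / |v|, so that real
    parts of pairings determine the norm. *)
Lemma cstar_norm_le_dot x (P : R) : 0 <= P ->
    (forall pi (v w : pi), rnorm v <= 1 -> rnorm w <= 1 -> Re (hdot pi (rep_ext x v) w) <= P) ->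
  cstar_norm x <= P.
Proof.
move=> P0 h; apply: cstar_norm_le => // pi; apply: best_constant_le => // v.
have [->|w0] := eqVneq (rnorm (rep_ext x v)) 0; first by rewrite mulr_ge0 ?rnorm_ge0.
set w := rep_ext x v in w0 *.
have wp : 0 < rnorm w by rewrite lt_def w0 rnorm_ge0.
have v0 : rnorm v != 0.
  apply: contraNneq w0 => v0; rewrite eq_le rnorm_ge0 andbT.
  by have := cstar_normP x v; rewrite v0 mulr0.
have vp : 0 < rnorm v by rewrite lt_def v0 rnorm_ge0.
have unit (u : pi) : 0 < rnorm u -> rnorm ((rnorm u)^-1%:C *: u) <= 1.
  by move=> u0; rewrite rnormZr ger0_norm ?invr_ge0 ?rnorm_ge0// mulVf ?gt_eqF.
have := h pi _ _ (unit _ vp) (unit _ wp).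
rewrite rep_extZv -/w dotZl dotZr conj_real !ReMr dotvv/= expr2 mulKf//.
by rewrite ler_pdivrMl// mulrC.
Qed.

(** The real part of <A (v, w), (v, w)> for the triangular 2 x 2 matrix A with diagonal a, b and
    corner y. *)
Definition num_value pi (v w : pi) a b y : R :=
  Re (hdot pi (rep_ext a v) v) + Re (hdot pi (rep_ext b w) w) + Re (hdot pi (rep_ext y v) w).

(** v and w range over separate unit balls: on the joint ball the corner alone would only count for
    half its norm, and the constant m would be lost. *)
Definition num_bound (M : R) a b y := 0 <= M /\
  forall pi (v w : pi), rnorm v <= 1 -> rnorm w <= 1 -> num_value v w a b y <= M.

Lemma num_boundD M N a b y a' b' y' : num_bound M a b y -> num_bound N a' b' y' ->
  num_bound (M + N) (a + a') (b + b') (y + y').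
Proof.
move=> [M0 hM] [N0 hN]; split=> [|pi v w v1 w1]; first exact: addr_ge0.
have := lerD (hM pi v w v1 w1) (hN pi v w v1 w1).
rewrite /num_value !rep_extD !dotDl !ReD.
by rewrite (addrACA (_ + _) (Re _)) (addrACA (Re _) (Re _)).
Qed.

Lemma num_boundZ (t : R) M a b y : 0 < t -> num_bound M a b y ->
  num_bound (t * M) (t%:C *: a) (t%:C *: b) (t%:C *: y).
Proof.
move=> t0 [M0 hM]; split=> [|pi v w v1 w1]; first by rewrite mulr_ge0// ltW.
have -> : num_value v w (t%:C *: a) (t%:C *: b) (t%:C *: y) = t * num_value v w a b y.
  have e x (u u' : pi) : Re (hdot pi (rep_ext (t%:C *: x) u) u') =
    t * Re (hdot pi (rep_ext x u) u') by rewrite rep_extZ dotZl ReMr.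
  by rewrite /num_value 2!mulrDr; congr (_ + _ + _); exact: e.
by rewrite ler_wpM2l ?hM ?(ltW t0).
Qed.

Lemma num_bound_diag a b : num_bound (cstar_norm a + cstar_norm b) a b 0.
Proof.
split=> [|pi v w v1 w1]; first by rewrite addr_ge0 ?cstar_norm_ge0.
by rewrite /num_value rep_ext0 dot0l addr0 lerD ?Re_dot_le.
Qed.

(** The diagonal terms are moved to the other side. This bounds from below the infimum that defines
    F in [diagonal_extension]. *)
Lemma num_bound_corner M a b y : num_bound M a b y ->
  cstar_norm y <= M + (cstar_norm a + cstar_norm b).
Proof.
move=> [M0 hM]; apply: cstar_norm_le_dot => [|pi v w v1 w1].
  by rewrite !addr_ge0 ?cstar_norm_ge0.
have := hM pi v w v1 w1; rewrite /num_value.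
have := @Re_dot_le pi (- v) v a; have := @Re_dot_le pi (- w) w b.
rewrite !rnormN !rep_extNv !dotNl !ReN => /(_ w1 w1) hb /(_ v1 v1) ha.
have aux (A B Y c d : R) : A + B + Y <= M -> - A <= c -> - B <= d -> Y <= M + (c + d).
  by clear => *; lra.
by move=> h; exact: aux h ha hb.
Qed.

Section form.
Variable phi : BG.
Local Notation m := (fs_norm phi).

(* [phi] is dominated by the norm of the off-diagonal corner of the 2 x 2
   matrices over C*(G); the diagonal corners of a Hahn-Banach extension make it
   completely positive (Paulsen's trick). *)
Lemma diagonal_extension : exists F : CG -> CG -> R,
  [/\ forall a b a' b', F (a + a') (b + b') = F a b + F a' b',
      forall t a b, F (t%:C *: a) (t%:C *: b) = t * F a b &
      forall M a b y, num_bound M a b y -> F a b + Re (pairing phi y) <= m * M].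
Proof.
pose S a b := [set r | exists M y, num_bound M a b y /\ r = m * M - Re (pairing phi y)].
have [a b|a b|a b a' b' _ _ [M [y [hM ->]]] [N [z [hN ->]]]|t a b _ t0 [M [y [hM ->]]]|
    F [FD FZ FS]] := @inf_sublinear_minorant R CG CG S.
- exists (m * (cstar_norm a + cstar_norm b) - Re (pairing phi 0)).
  exists (cstar_norm a + cstar_norm b), 0; split=> //; exact: num_bound_diag.
- exists (- (m * (cstar_norm a + cstar_norm b))).
  move=> _ [M [y [/num_bound_corner/(ler_wpM2l (fs_norm_ge0 phi)) hM ->]]].
  have := le_trans (Re_le_rnorm _) (fs_normP phi y); move: hM; rewrite mulrDr.
  move: (m * M) (m * cstar_norm y) (m * (_ + _)) (Re _); clear=> r1 r2 r3 r4 *.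
  by lra.
- exists (m * (M + N) - Re (pairing phi (y + z))).
    exists (M + N), (y + z); split=> //; exact: num_boundD hM hN.
  by rewrite pairingDr ReD mulrDr opprD addrACA.
- exists (m * (t * M) - Re (pairing phi (t%:C *: y))).
    exists (t * M), (t%:C *: y); split=> //; exact: num_boundZ t0 hM.
  by rewrite pairingZr ReMr mulrBr mulrCA.
exists F; split=> // M a b y hM; rewrite -lerBrDr; apply: FS.
by exists M, y.
Qed.

Section with_extension.
Variable F : CG -> CG -> R.
Hypotheses (FD : forall a b a' b', F (a + a') (b + b') = F a b + F a' b')
  (FZ : forall t a b, F (t%:C *: a) (t%:C *: b) = t * F a b)
  (Fle : forall M a b y, num_bound M a b y -> F a b + Re (pairing phi y) <= m * M).

(** With M = 0, domination by a norm turns into positivity. *)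
Let F_le0 a b y : (forall pi (v w : pi), num_value v w a b y <= 0) ->
  F a b + Re (pairing phi y) <= 0.
Proof. by move=> h; rewrite -(mulr0 m); apply: Fle; split. Qed.

Let F_mono a b c d :
  (forall pi (v w : pi), num_value v w a b 0 <= num_value v w c d 0) -> F a b <= F c d.
Proof.
move=> h; rewrite -subr_le0 -(real_linear2_B FD FZ).
have p0 : Re (pairing phi 0) = 0 by rewrite /pairing msupp0 big_seq_fset0.
rewrite -[leLHS]addr0 -{1}p0; apply: F_le0 => pi v w.
have := h pi v w; rewrite /num_value rep_ext0 dot0l addr0 (rep_extB a c) (rep_extB b d).
by rewrite 2!dotBl 2!ReD 2!ReN addr0 -subr_le0 opprD addrACA addr0.
Qed.

(** a and its adjoint have the same real diagonal values <pi(a) v, v>, and F is monotone in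
    these. *)
Let F_star a b : F (cg_star a) (cg_star b) = F a b.
Proof.
have e pi (v w : pi) : num_value v w (cg_star a) (cg_star b) 0 = num_value v w a b 0.
  by rewrite /num_value 2!rep_ext_star (dotC v) (dotC w) 2!ReC.
by apply/eqP; rewrite eq_le; apply/andP; split; apply: F_mono => pi v w; rewrite e.
Qed.

Let Fc a b : C := complexify F a b.

Let Fc_lin k a b a' b' : Fc (k *: a + a') (k *: b + b') = k * Fc a b + Fc a' b'.
Proof. exact: complexify_lin. Qed.

Let Fc_star a b : Fc (cg_star a) (cg_star b) = (Fc a b)^*.
Proof.
apply: complex_eq; rewrite ?ReC ?ImC/=; first exact: F_star.
have star_i x : cg_star ('i *: x) = - ('i *: cg_star x) :> CG.
  by rewrite cg_starZ conjCi scaleNr.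
have e : F (- ('i *: cg_star a)) (- ('i *: cg_star b)) = F ('i *: a) ('i *: b).
  transitivity (F (cg_star ('i *: a)) (cg_star ('i *: b))); last exact: F_star.
  by congr F; exact/esym/star_i.
by rewrite opprK -(real_linear2_N FD FZ); exact: e.
Qed.

(* With u = Fc(., 0) and v = Fc(0, .), [form] is the semi-inner product on
   C[G] + C[G] of the GNS construction for the positive functional given by the
   matrix ((u, phi), (phi^*, v)). *)
Let corners a b c d : C := Fc a b + (pairing phi c + (pairing phi d)^*).

Let form x y x' y' : C :=
  corners (cg_mul (cg_star x') x) (cg_mul (cg_star y') y)
    (cg_mul (cg_star y') x) (cg_mul (cg_star y) x').

Let eq_corners a b c d a' b' c' d' : a = a' -> b = b' -> c = c' -> d = d' ->
  corners a b c d = corners a' b' c' d'.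
Proof. by move=> -> -> -> ->. Qed.

Let form_lin k x y x' y' z t :
  form (k *: x + x') (k *: y + y') z t = k * form x y z t + form x' y' z t.
Proof.
have e1 u v u' v' w w' : Fc (cg_mul w (k *: u + v)) (cg_mul w' (k *: u' + v')) =
    k * Fc (cg_mul w u) (cg_mul w' u') + Fc (cg_mul w v) (cg_mul w' v').
  by rewrite -Fc_lin; congr Fc; exact: cg_mul_linr.
have e2 u v w : pairing phi (cg_mul w (k *: u + v)) =
    k * pairing phi (cg_mul w u) + pairing phi (cg_mul w v).
  by rewrite cg_mul_linr pairingDr pairingZr.
have e3 u v w : (pairing phi (cg_mul (cg_star (k *: u + v)) w))^* =
    k * (pairing phi (cg_mul (cg_star u) w))^* + (pairing phi (cg_mul (cg_star v) w))^*.
  by rewrite cg_star_lin cg_mul_linl pairingDr pairingZr rmorphD rmorphM/= conjCK.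
have aux (A1 A2 B1 B2 C1 C2 : C) : k * A1 + A2 + (k * B1 + B2 + (k * C1 + C2)) =
  k * (A1 + (B1 + C1)) + (A2 + (B2 + C2)) by ring.
by rewrite -[RHS]aux; congr (_ + (_ + _)); [exact: e1|exact: e2|exact: e3].
Qed.

Let form_sym x y x' y' : form x y x' y' = (form x' y' x y)^*.
Proof.
have e u v : cg_star (cg_mul (cg_star u) v) = cg_mul (cg_star v) u.
  by rewrite cg_starM cg_starK.
have aux (A B D : C) : A^* + (B + D^*) = (A + (D + B^*))^*.
  by rewrite 2!rmorphD /= conjCK (addrC B).
rewrite /form /corners -[RHS]aux; congr (_ + _).
by rewrite -[RHS]Fc_star; congr Fc; exact/esym/e.
Qed.

Let form_ge0 x y : 0 <= Re (form x y x y).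
Proof.
pose a := cg_mul (cg_star x) x; pose b := cg_mul (cg_star y) y.
(* [num_value] has a single corner where [form] has two conjugate ones, hence the doubling: the
   value at (v, w) becomes |pi(x) v + pi(y) w|^2. *)
pose c := cg_mul (cg_star y) x; pose c2 : CG := c + c.
have val_ge0 pi (v w : pi) : 0 <= num_value v w a b c2.
  have dotE u z (p q : pi) : hdot pi (rep_ext (cg_mul (cg_star u) z) p) q =
      hdot pi (rep_ext z p) (rep_ext u q).
    by rewrite rep_ext_mul rep_ext_star.
  have ha : Re (hdot pi (rep_ext a v) v) = rnorm (rep_ext x v) ^+ 2.
    by rewrite dotE dotvv.
  have hb : Re (hdot pi (rep_ext b w) w) = rnorm (rep_ext y w) ^+ 2.
    by rewrite dotE dotvv.
  have hc : Re (hdot pi (rep_ext c2 v) w) = 2 * Re (hdot pi (rep_ext x v) (rep_ext y w)).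
    by rewrite rep_extD dotDl ReD dotE mulr_natl mulr2n.
  rewrite /num_value ha hb hc; have := sqr_ge0 (rnorm (rep_ext x v + rep_ext y w)).
  by rewrite rnormD2 addrAC.
have : F (- a) (- b) + Re (pairing phi (- c2)) <= 0.
  apply: F_le0 => pi v w; rewrite -oppr_ge0.
  suff -> : num_value v w (- a) (- b) (- c2) = - num_value v w a b c2.
    by rewrite opprK val_ge0.
  have repN u (p : pi) : rep_ext (- u) p = - rep_ext u p.
    by rewrite -[- u]scaleN1r rep_extZ scaleN1r.
  have e u (p q : pi) : Re (hdot pi (rep_ext (- u) p) q) = - Re (hdot pi (rep_ext u p) q).
    by rewrite repN dotNl ReN.
  have n3 (r s t : R) : - r - s - t = - (r + s + t) by rewrite 2!opprD.
  by rewrite /num_value -[RHS]n3; congr (_ + _ + _); exact: e.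
rewrite (real_linear2_N FD FZ) -[- c2]scaleN1r pairingZr mulN1r ReN -opprD oppr_le0.
have -> : Re (pairing phi c2) = Re (pairing phi c) + Re (pairing phi c).
  by rewrite pairingDr ReD.
by rewrite /form /corners 2!ReD ReC.
Qed.

Let delta_unit g : cg_mul (cg_star (delta 1 g)) (delta 1 g) = delta 1 1%g :> CG.
Proof. by rewrite cg_star_delta cg_mul_delta rmorph1 mulr1 mulVg. Qed.

Let act g x : CG := cg_mul (delta 1 g) x.

Lemma form_coef : exists pi (v w : pi),
  [/\ phi = coef v w, rnorm v ^+ 2 <= m & rnorm w ^+ 2 <= m].
Proof.
have act_lin g k x y : act g (k *: x + y) = k *: act g x + act g y.
  exact: cg_mul_linr.
have act1 x : act 1%g x = x by exact: cg_mul1.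
have actM g h x : act (g * h)%g x = act g (act h x).
  by rewrite /act cg_mulA cg_mul_delta mulr1.
have act_mul g x y : cg_mul (cg_star (act g x)) (act g y) = cg_mul (cg_star x) y.
  by rewrite cg_starM -cg_mulA (cg_mulA (cg_star (delta 1 g))) delta_unit cg_mul1.
have act_iso g x y x' y' : form (act g x) (act g y) (act g x') (act g y') = form x y x' y'.
  by apply: eq_corners; exact: act_mul.
have [pi [e [e_dot e_act]]] := gns_pair form_lin form_sym form_ge0 act_lin act_lin
  act1 act1 actM actM act_iso.
have star1 : cg_star (delta 1 1%g) = delta 1 1%g :> CG.
  by rewrite cg_star_delta invg1 rmorph1.
have p0 : pairing phi 0 = 0 by rewrite /pairing msupp0 big_seq_fset0.
have Fc00 : Fc 0 0 = 0.
  have F00 : F 0 0 = 0 by have := FZ 0 0 0; rewrite !scaler0 mul0r.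
  by rewrite /Fc /complexify !scaler0 F00 oppr0.
have c1 : cstar_norm (delta 1 1%g : CG) <= 1.
  by rewrite (le_trans (cstar_norm_delta _ _))// /rnorm normr1.
have c0 : cstar_norm (0 : CG) = 0.
  apply/eqP; rewrite eq_le cstar_norm_ge0 andbT; apply: cstar_norm_le_dot => // pi' v w _ _.
  by rewrite rep_ext0 dot0l.
(* Between (g, 0) and (0, 1) only the corner phi(g) is left of [form]. The squared norms of the two
   vectors are F(1, 0) and F(0, 1), which the bound at y = 0 limits to m. *)
exists pi, (e (delta 1 1%g) 0), (e 0 (delta 1 1%g)); split.
- apply: fsP => g /=; rewrite e_act e_dot.
  have -> : form (act g (delta 1 1%g)) (act g 0) 0 (delta 1 1%g) = corners 0 0 (delta 1 g) 0.
    apply: eq_corners; rewrite /act.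
    + by rewrite cg_star0 cg_mul0l.
    + by rewrite (cg_mul0r (delta 1 g)) cg_mul0r.
    + by rewrite star1 cg_mul1 cg_mul_delta mulr1 mulg1.
    + by rewrite cg_mul0r.
  by rewrite /corners Fc00 p0 rmorph0 addr0 add0r pairing_delta.
- have -> : rnorm (e (delta 1 1%g) 0) ^+ 2 = F (delta 1 1%g) 0.
    have := congr1 (fun z : C => Re z) (dotvv (e (delta 1 1%g) 0)); rewrite e_dot /= => <-.
    have -> : form (delta 1 1%g) 0 (delta 1 1%g) 0 = corners (delta 1 1%g) 0 0 0.
      by apply: eq_corners; rewrite ?star1 ?cg_mul1 ?cg_mul0r// cg_star0 cg_mul0l.
    by rewrite /corners p0 rmorph0 2!addr0.
  have := Fle (num_bound_diag (delta 1 1%g) 0); rewrite p0 addr0 c0 addr0.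
  by move/le_trans; apply; rewrite -[leRHS]mulr1 ler_wpM2l ?fs_norm_ge0.
- have -> : rnorm (e 0 (delta 1 1%g)) ^+ 2 = F 0 (delta 1 1%g).
    have := congr1 (fun z : C => Re z) (dotvv (e 0 (delta 1 1%g))); rewrite e_dot /= => <-.
    have -> : form 0 (delta 1 1%g) 0 (delta 1 1%g) = corners 0 (delta 1 1%g) 0 0.
      by apply: eq_corners; rewrite ?star1 ?cg_mul1 ?cg_mul0r// cg_star0 cg_mul0l.
    by rewrite /corners p0 rmorph0 2!addr0.
  have := Fle (num_bound_diag 0 (delta 1 1%g)); rewrite p0 addr0 c0 add0r.
  by move/le_trans; apply; rewrite -[leRHS]mulr1 ler_wpM2l ?fs_norm_ge0.
Qed.

End with_extension.
Lemma fs_is_coef : exists pi (v w : pi),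
  [/\ phi = coef v w, rnorm v ^+ 2 <= m & rnorm w ^+ 2 <= m].
Proof. by have [F [FD FZ Fle]] := diagonal_extension; exact: (form_coef FD FZ Fle). Qed.

End form.
End representation.
(** * Closed bi-invariant subspaces *)

Section intertwiners.
Context {R : realType} {G : groupType}.
Local Notation C := R[i].
Implicit Types pi rho : unitary_rep R G.

Lemma closed_orthogonal pi (I : Type) (f : I -> pi) :
  closed [set w | forall i, hdot pi (f i) w = 0].
Proof.
apply: approx_closed => w aw i; apply: (@rnorm_eq0 _ C^o); apply/eqP.
rewrite eq_le rnorm_ge0 andbT; apply/ler_addgt0Pr => e e0; rewrite add0r.
have f1 : 0 < 1 + rnorm (f i) by rewrite ltr_pwDl ?rnorm_ge0.
have [u /(_ i) fu wu] := aw (e / (1 + rnorm (f i))) (divr_gt0 e0 f1).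
rewrite -[hdot pi (f i) w]subr0 -fu -dotBr (le_trans (dot_le _ _))//.
move: wu; rewrite ltr_pdivlMr// => /ltW; apply: le_trans.
by rewrite mulrC ler_wpM2l ?rnorm_ge0// lerDr.
Qed.

Lemma subspace_orthogonal pi (I : Type) (f : I -> pi) :
  subspace [set w | forall i, hdot pi (f i) w = 0].
Proof.
split=> [i|k u v hu hv i]; first exact: dot0r.
by rewrite dotDr dotZr hu hv mulr0 addr0.
Qed.

Lemma oproj_act pi (K : set pi) g v : subspace K -> closed K ->
    (forall h w, K w -> K (rep_act pi h w)) ->
  oproj K (rep_act pi g v) = rep_act pi g (oproj K v).
Proof.
move=> sK cK iK; have [KP oP] := oprojP sK cK v.
apply: oproj_uniq => // [|y Ky]; first exact: iK.
by rewrite -linearB rep_act_adj oP//; exact: iK.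
Qed.

End intertwiners.

Section biinvariant_subspace.
Context {R : realType} {G : groupType}.
Local Notation C := R[i].
Local Notation BG := (fourier_stieltjes R G).
Local Notation WG := (wstar R G).
Implicit Types (pi rho : unitary_rep R G) (phi psi : BG) (g h : G).

Lemma wact_l_deltaE g phi : wact_l (wstar_iota (delta 1 g)) phi = ltrans g phi.
Proof. by apply: fsP => h /=; rewrite pairing_delta. Qed.

Lemma wact_r_deltaE g phi : wact_r phi (wstar_iota (delta 1 g)) = rtrans phi g.
Proof. by apply: fsP => h /=; rewrite pairing_delta. Qed.

Variable X : set BG.
Hypotheses (sX : is_subspace X) (cX : closed X) (bX : is_biinvariant X).

Let X_ltrans g phi : X phi -> X (ltrans g phi).
Proof. by move=> Xphi; rewrite -wact_l_deltaE; exact: bX.1. Qed.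

Let X_rtrans g phi : X phi -> X (rtrans phi g).
Proof. by move=> Xphi; rewrite -wact_r_deltaE; exact: bX.2. Qed.

Let X_approx (I : normedModType C) (f : I -> BG) (M : R) (v : I) :
  (forall u u', fs_norm (f u - f u') <= rnorm (u - u') * M) ->
  approx [set u | X (f u)] v -> X (f v).
Proof.
move=> fM av; apply: closed_approx => // e e0.
have M1 : 0 < 1 + `|M| by rewrite ltr_pwDl.
have [u Xu vu] := av (e / (1 + `|M|)) (divr_gt0 e0 M1).
exists (f u) => //; rewrite fs_normE; move: vu; rewrite ltr_pdivlMr//.
apply: le_lt_trans; rewrite (le_trans (fM _ _))// ler_wpM2l ?rnorm_ge0//.
by rewrite (le_trans (ler_norm _))// lerDr.
Qed.

(* The largest subrepresentation all of whose coefficients are in [X]. *)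
Definition xspace pi : set pi := [set v | forall w, X (coef v w)].

Lemma subspace_xspace pi : subspace (@xspace pi).
Proof.
split=> [w|k u v hu hv w]; last by rewrite coef_linl; apply: sX.2.
suff -> : coef 0 w = 0 by exact: sX.1.
by apply: fsP => g /=; rewrite linear0 dot0l.
Qed.

Lemma closed_xspace pi : closed (@xspace pi).
Proof.
apply: approx_closed => v av w; apply: (@X_approx pi (fun u => coef u w) (rnorm w)) => [u u'|e e0].
  rewrite (_ : _ - _ = coef (u - u') w); first exact: fs_norm_coef.
  by apply: fsP => g; rewrite [RHS]/= linearB dotBl.
by have [u hu vu] := av e e0; exists u => //; exact: hu.
Qed.

Lemma xspace_act pi g v : @xspace pi v -> xspace (rep_act pi g v).
Proof. by move=> hv w; rewrite -ltrans_coef; exact: X_ltrans. Qed.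

Local Notation P := (oproj (@xspace _)).

(** Coefficients of T u are coefficients of u, and likewise for the adjoint S. Both maps thus
    preserve [xspace], so that T respects the orthogonal decompositions. *)
Lemma xproj_intertwine pi rho (T : pi -> rho) (S : rho -> pi) :
    (forall v w, hdot rho (T v) w = hdot pi v (S w)) ->
    (forall g v, T (rep_act pi g v) = rep_act rho g (T v)) ->
  forall v, P (T v) = T (P v).
Proof.
move=> adj act v; have [xP oP] := oprojP (@subspace_xspace pi) (@closed_xspace pi) v.
have coefT u w : coef (T u) w = coef u (S w).
  by apply: fsP => g /=; rewrite -act adj.
have coefS u w : coef (S u) w = coef u (T w).
  by apply: fsP => g /=; rewrite 2!rep_act_adj -act dotC -adj -dotC.
apply: oproj_uniq => [||w|y hy]; [exact: subspace_xspace|exact: closed_xspace| |].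
  by rewrite coefT.
have xS : xspace (S y) by move=> w; rewrite coefS.
by rewrite dotBl !adj -dotBl oP.
Qed.

(** The projection Q onto the orthogonal L of the orbit of v is a self-adjoint intertwiner with Q v
    = 0 and Q w = w. It commutes with P, hence <P v, w> = <Q P v, w> = <P Q v, w> = 0. *)
Lemma xproj_coef0 pi (v w : pi) :
  (forall g, hdot pi (rep_act pi g v) w = 0) -> hdot pi (P v) w = 0.
Proof.
move=> h; pose L := [set u | forall g, hdot pi (rep_act pi g v) u = 0].
have sL : subspace L by exact: subspace_orthogonal.
have cL : closed L by exact: closed_orthogonal.
have iL g u : L u -> L (rep_act pi g u).
  by move=> Lu k; rewrite dotC rep_act_adj -rep_actM -dotC Lu.
have adj : forall u u', hdot pi (oproj L u) u' = hdot pi u (oproj L u').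
  by move=> u u'; exact: oproj_adj.
have comm := xproj_intertwine adj (fun g u => oproj_act g u sL cL iL).
have Lw : L w by [].
rewrite -(oproj_id sL cL Lw) -adj -comm (oproj_orth0 sL cL); last first.
  by move=> y /(_ 1%g); rewrite rep_act1.
by rewrite oproj_id ?dot0l//; [exact: subspace_xspace|exact: closed_xspace|exact/subspace0/subspace_xspace].
Qed.

Local Notation xdot v w := (hdot _ (P v) w).

(** Used twice: k = -1 shows that [zfun] is well defined, and a general k that it is linear. The
    embeddings into the direct sum have adjoints, so that the projections P are compatible with
    them. *)
Lemma coef_sum pi rho (k : C) (v w : pi) (v' w' : rho) :
  exists (sigma : unitary_rep R G) (s t : sigma),
    coef s t = k *: coef v w + coef v' w' /\ xdot s t = k * xdot v w + xdot v' w'.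
Proof.
have [sigma [i [j [[i_lin i_dot i_act] [j_lin j_dot j_act] ij]]]] := rep_sum pi rho.
have ji u u' : hdot sigma (j u) (i u') = 0 by rewrite dotC ij rmorph0.
have i_norm u : rnorm (i u) <= rnorm u.
  rewrite -(@ler_pXn2r _ 2)// ?nnegrE ?rnorm_ge0//.
  by have := congr1 (fun z : C => Re z) (i_dot u u); rewrite !dotvv /= => ->.
have j_norm u : rnorm (j u) <= rnorm u.
  rewrite -(@ler_pXn2r _ 2)// ?nnegrE ?rnorm_ge0//.
  by have := congr1 (fun z : C => Re z) (j_dot u u); rewrite !dotvv /= => ->.
have [i' i_adj] := adjoint i_lin i_norm; have [j' j_adj] := adjoint j_lin j_norm.
have Pi := xproj_intertwine i_adj (fun g u => esym (i_act g u)).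
have Pj := xproj_intertwine j_adj (fun g u => esym (j_act g u)).
exists sigma, (k *: i v + j v'), (i w + j w'); split.
  apply: fsP => g; rewrite [LHS]/= linearP dotDl dotZl 2!dotDr i_act j_act.
  by rewrite i_dot j_dot ij ji addr0 add0r.
rewrite (oproj_lin (@subspace_xspace _) (@closed_xspace _)) dotDl dotZl 2!dotDr Pi Pj.
by rewrite i_dot j_dot ij ji addr0 add0r.
Qed.

Lemma xdot_coef pi rho (v w : pi) (v' w' : rho) :
  coef v w = coef v' w' -> xdot v w = xdot v' w'.
Proof.
move=> e; have [sigma [s [t [cst]]]] := coef_sum (-1) v w v' w'.
rewrite xproj_coef0 => [|g]; first by rewrite mulN1r addrC => /esym/subr0_eq ->.
have := congr1 (fun f : BG => f g) cst; rewrite e scaleN1r addNr; exact.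
Qed.

(* The value at 1 of the component of [phi] in [X]; as every [phi] is a
   coefficient, the default value of [xget] is not used. *)
Definition zfun phi : C :=
  xget 0 [set c | exists pi (v w : pi), phi = coef v w /\ c = xdot v w].

Lemma zfun_coef pi (v w : pi) : zfun (coef v w) = xdot v w.
Proof.
rewrite /zfun; case: xgetP => [_ -> [rho [v' [w' [e ->]]]]|/(_ (xdot v w))[]].
  exact/esym/xdot_coef.
by exists pi, v, w.
Qed.

Fact zfun_subproof : zfun \in @wstar_pred R G.
Proof.
apply: wstar_predI => [k phi psi|].
  have [pi [v [w [-> _ _]]]] := fs_is_coef phi.
  have [rho [v' [w' [-> _ _]]]] := fs_is_coef psi.
  have [sigma [s [t [<- e]]]] := coef_sum k v w v' w'.
  by rewrite !zfun_coef e.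
exists 1 => phi; have [pi [v [w [e hv hw]]]] := fs_is_coef phi.
rewrite {1}e zfun_coef mul1r (le_trans (dot_le _ _))//.
have Pv : rnorm (P v) <= rnorm v.
  by apply: oproj_norm; [exact: subspace_xspace|exact: closed_xspace].
rewrite (le_trans (ler_wpM2r (rnorm_ge0 w) Pv))//.
(* |v| |w| <= (|v|^2 + |w|^2) / 2 <= |phi|. *)
have := sqr_ge0 (rnorm v - rnorm w); rewrite sqrrB mulr2n => ?; lra.
Qed.

Definition zproj : WG := WStar zfun_subproof.

Lemma zproj_coef pi (v w : pi) : wact_l zproj (coef v w) = coef (P v) w.
Proof. by apply: fsP => g /=; rewrite rtrans_coef zfun_coef rep_act_adj. Qed.

Lemma zproj_in phi : X (wact_l zproj phi).
Proof.
have [pi [v [w [-> _ _]]]] := fs_is_coef phi; rewrite zproj_coef.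
by have [+ _] := oprojP (@subspace_xspace pi) (@closed_xspace pi) v; apply.
Qed.

(** Let Q be the projection onto the closed subrepresentation K, which contains w. As [coef (Q v) u]
    equals [coef v (Q u)], the vector Q v is in [xspace] and P fixes it: <P v, w> = <P v, Q w> = <P
    Q v, w> = <Q v, w> = <v, w>. *)
Lemma zproj_val phi : X phi -> zproj phi = phi 1%g.
Proof.
move=> Xphi; have [pi [v [w [e _ _]]]] := fs_is_coef phi.
pose K := [set u : pi | X (coef v u)].
have sK : subspace K.
  split=> [|k u u' hu hu']; last by rewrite /K/= coef_linr; apply: sX.2.
  suff -> : K 0 = X 0 by exact: sX.1.
  by congr X; apply: fsP => g /=; rewrite dot0r.
have cK : closed K.
  apply: approx_closed => u au; apply: (@X_approx pi (fun u => coef v u) (rnorm v)) => // u1 u2.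
  rewrite mulrC (_ : _ - _ = coef v (u1 - u2)); first exact: fs_norm_coef.
  by apply: fsP => g; rewrite [RHS]/= dotBr.
have iK g u : K u -> K (rep_act pi g u).
  by move=> hu; rewrite /K/= -[g]invgK -rtrans_coef; exact: X_rtrans.
have Kw : K w by rewrite /K/= -e.
have adj : forall u u', hdot pi (oproj K u) u' = hdot pi u (oproj K u').
  by move=> u u'; exact: oproj_adj.
have comm := xproj_intertwine adj (fun g u => oproj_act g u sK cK iK).
have xq : xspace (oproj K v).
  move=> u; have -> : coef (oproj K v) u = coef v (oproj K u).
    by apply: fsP => g /=; rewrite -(oproj_act g v sK cK iK) adj.
  exact: (oprojP sK cK u).1.
rewrite e [LHS]zfun_coef /= rep_act1 -{1}(oproj_id sK cK Kw) -adj -comm.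
rewrite (oproj_id (@subspace_xspace _) (@closed_xspace _) xq) adj.
by rewrite (oproj_id sK cK Kw).
Qed.

Lemma rtrans1 phi : rtrans phi 1%g = phi.
Proof. by apply: fsP => g /=; rewrite mul1g. Qed.

Lemma wact_l1 (a : WG) phi : wact_l a phi 1%g = a phi.
Proof. by rewrite /= rtrans1. Qed.

Lemma zproj_id phi : X phi -> wact_l zproj phi = phi.
Proof.
move=> Xphi; apply: fsP => g; rewrite [LHS]zproj_val; last exact: X_rtrans.
by rewrite /= mulg1.
Qed.

Lemma wact_l_coef (b : WG) pi (v : pi) :
  exists u, forall w, b (coef v w) = hdot pi u w.
Proof.
have [M M0 hM] := wstar_bounded b.
have [k u u'|w|u hu] := @riesz R pi (fun w => (b (coef v w))^*) (M * rnorm v).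
- by rewrite coef_linr wstar_lin rmorphD rmorphM/= conjCK.
- rewrite rnormCj (le_trans (hM _))// -mulrA ler_wpM2l//; exact: fs_norm_coef.
- by exists u => w; rewrite dotC -hu conjCK.
Qed.

Lemma zproj_central : is_central_projection zproj.
Proof.
split; [split|].
- apply: wstarP => phi; rewrite -[LHS]/(zproj (wact_l zproj phi)).
  by rewrite zproj_val ?wact_l1//; exact: zproj_in.
- apply: wstarP => phi; have [pi [v [w [-> _ _]]]] := fs_is_coef phi.
  rewrite -[LHS]/((zproj (fs_star (coef v w)))^*) fs_star_coef.
  rewrite [X in X^*]zfun_coef [RHS]zfun_coef -dotC.
  by rewrite (oproj_adj (@subspace_xspace _) (@closed_xspace _)).
- move=> b; apply: wstarP => phi; have [pi [v [w [-> _ _]]]] := fs_is_coef phi.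
  rewrite -[LHS]/(zproj (wact_l b (coef v w))) -[RHS]/(b (wact_l zproj (coef v w))).
  rewrite zproj_coef; have [u hu] := wact_l_coef b v.
  have -> : wact_l b (coef v w) = coef u w.
    by apply: fsP => g /=; rewrite rtrans_coef hu rep_act_adj.
  have comm g y : P (rep_act pi g y) = rep_act pi g (P y).
    apply: oproj_act; [exact: subspace_xspace|exact: closed_xspace|exact: xspace_act].
  have adj := oproj_adj (@subspace_xspace pi) (@closed_xspace pi).
  (* With P moved to the right, both sides become <u, P w>. *)
  have -> : coef (P v) w = coef v (P w).
    by apply: fsP => g /=; rewrite -comm adj.
  by rewrite [LHS]zfun_coef adj hu.
Qed.

Lemma biinvariant_projection : exists z : WG, is_central_projection z /\
  X = [set wact_l z phi | phi in setT].
Proof.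
exists zproj; split; first exact: zproj_central.
apply/seteqP; split=> [phi Xphi|_ [phi _ <-]]; last exact: zproj_in.
by exists phi => //; exact: zproj_id.
Qed.

End biinvariant_subspace.
(** * Central supports *)

Section central_support.
Context {R : realType} {G : groupType}.
Local Notation C := R[i].
Local Notation BG := (fourier_stieltjes R G).
Local Notation WG := (wstar R G).
Implicit Types (phi psi : BG) (a b z : WG) (x : {malg C[G]}).

Lemma wact_l_one phi : wact_l 1 phi = phi.
Proof. by apply: fsP => g; rewrite /= pairing_delta /= mulg1. Qed.

Lemma wact_lB a b phi : wact_l (a - b) phi = wact_l a phi - wact_l b phi.
Proof. by apply/eqP; rewrite eq_sym subr_eq -wact_lD subrK. Qed.

Lemma wact_lM a b phi : wact_l (a * b) phi = wact_l a (wact_l b phi).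
Proof. exact: wact_l_mul. Qed.

(** For a central, ((1 - a) b)(phi) = b(phi - a phi), and the elements b of G already separate
    B(G). *)
Lemma supported_byP a phi : is_central a -> supported_by phi a <-> wact_l a phi = phi.
Proof.
move=> ca; have c1a b : (1 - a) * b = b * (1 - a).
  by rewrite mulrBl mulrBr mul1r mulr1 ca.
have e b : ((1 - a) * b) phi = b (phi - wact_l a phi).
  by rewrite c1a -wact_lP wact_lB wact_l_one.
split=> [sa|pa b]; last by rewrite e pa subrr wstar0.
apply/esym/subr0_eq; apply: fsP => g; rewrite -pairing_delta.
by rewrite -[pairing _ _]/(wstar_iota (delta 1 g) _) -e sa.
Qed.

Lemma wact_l_cg_ext a (L : G -> BG) x : wact_l a (cg_ext L x) = cg_ext (fun g => wact_l a (L g)) x.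
Proof.
rewrite /cg_ext; elim/big_rec2: _ => [|g u v _ <-].
  by apply: fsP => h; rewrite /= -[RHS](wstar0 a); congr (a _); exact: fsP.
exact: wact_l_lin.
Qed.

Lemma wact_r_iota phi x : wact_r phi (wstar_iota x) = cg_ext (rtrans phi) x.
Proof. by apply: fsP => h; rewrite cg_ext_rtransE /= pairingE. Qed.

Lemma wact_l_r_iota a phi x :
  wact_l a (wact_r phi (wstar_iota x)) = wact_r (wact_l a phi) (wstar_iota x).
Proof.
rewrite !wact_r_iota wact_l_cg_ext; apply: eq_cg_ext => g.
by rewrite wact_l_rtrans.
Qed.

Definition supported a : set BG := [set phi | wact_l a phi = phi].

Lemma supported_subspace a : is_subspace (supported a).
Proof.
split=> [|k phi psi hphi hpsi]; last by rewrite /supported /= wact_l_lin hphi hpsi.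
by apply: fsP => g /=; rewrite -[RHS](wstar0 a); congr (a _); exact: fsP.
Qed.

Lemma supported_closed a : closed (supported a).
Proof.
have [M M0 hM] := wstar_bounded a.
have bound phi : fs_norm (wact_l a phi) <= M * fs_norm phi by exact: fs_norm_wact_l.
have actB phi psi : wact_l a (phi - psi) = wact_l a phi - wact_l a psi.
  by rewrite addrC -scaleN1r wact_l_lin scaleN1r addrC.
apply: approx_closed => phi aphi; apply/subr0_eq/(@rnorm_eq0 _ BG)/eqP.
rewrite eq_le rnorm_ge0 andbT; apply/ler_addgt0Pr => e e0; rewrite add0r.
have M1 : 0 < M + 1 by rewrite ltr_wpDl.
have [psi hpsi close] := aphi (e / (M + 1)) (divr_gt0 e0 M1).
have -> : wact_l a phi - phi = wact_l a (phi - psi) + (psi - phi).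
  by rewrite actB hpsi subrKA.
rewrite (le_trans (rnormD _ _))//; move: close; rewrite ltr_pdivlMr// mulrDr mulr1 => /ltW.
by apply: le_trans; rewrite lerD// ?(rnorm_distC psi)// mulrC; exact: bound.
Qed.

Lemma supported_biinvariant a : is_central a -> is_biinvariant (supported a).
Proof.
move=> ca; split=> x phi hphi; rewrite /supported/=.
  by rewrite -wact_lM ca wact_lM hphi.
by rewrite wact_l_r_iota hphi.
Qed.

Lemma central_support_exists phi : exists a : WG, is_central_support phi a.
Proof.
pose X := [set psi | forall Y : set BG, is_subspace Y -> closed Y -> is_biinvariant Y ->
  Y phi -> Y psi].
have sX : is_subspace X.
  split=> [Y sY *|k u v hu hv Y sY cY bY Yphi]; first exact: sY.1.
  by apply: sY.2; [exact: hu|exact: hv].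
have cX : closed X.
  apply: approx_closed => psi apsi Y sY cY bY Yphi; apply: closed_approx => // e e0.
  by have [u hu uv] := apsi e e0; exists u => //; exact: hu.
have bX : is_biinvariant X.
  split=> x psi hpsi Y sY cY bY Yphi.
    by apply: bY.1; exact: hpsi.
  by apply: bY.2; exact: hpsi.
have [z [cz XE]] := biinvariant_projection sX cX bX.
have zid psi : X psi -> wact_l z psi = psi.
  rewrite {1}XE => -[chi _ <-]; by rewrite -wact_lM cz.1.1.
exists z; split=> //.
  by apply/supported_byP; [exact: cz.2|apply: zid => Y].
move=> b cb /(supported_byP _ cb.2) bphi.
rewrite /proj_le cz.2; apply: wstarP => psi; rewrite -wact_lP -!wact_l1.
(* X is contained in the closed bi-invariant subspace [supported b], so that b fixes every z psi;
   this is z <= b. *)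
have Xz : X (wact_l z psi) by rewrite XE; exists psi.
have -> : wact_l b (wact_l z psi) = wact_l z psi; last by [].
exact: (Xz _ (supported_subspace b) (@supported_closed b) (supported_biinvariant cb.2)).
Qed.

Lemma central_supportP phi : is_central_support phi (central_support phi).
Proof. by rewrite /central_support; exact: xgetPex (central_support_exists phi). Qed.

Lemma wact_l_central_support phi : wact_l (central_support phi) phi = phi.
Proof.
by have [[_ c] s _] := central_supportP phi; exact/(supported_byP _ c).
Qed.

Lemma central_support_le phi a : is_central_projection a -> wact_l a phi = phi ->
  proj_le (central_support phi) a.
Proof.
move=> ca aphi; have [_ _ min] := central_supportP phi.
by apply: min => //; exact/(supported_byP _ ca.2).
Qed.

(** The central support of phi commutes with both actions of C[G], hence still fixes the translates
    of phi and dominates their central supports. *)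
Lemma L_space_biinvariant (X : set BG) : is_L_space X -> is_biinvariant X.
Proof.
move=> LX; split=> x phi Xphi; apply: (LX phi) => //; apply: central_support_le.
- by have [] := central_supportP phi.
- have [[_ c] _ _] := central_supportP phi.
  by rewrite -wact_lM c wact_lM wact_l_central_support.
- by have [] := central_supportP phi.
- by rewrite wact_l_r_iota wact_l_central_support.
Qed.

(** z dominates the central support of z phi, hence that of psi, and therefore fixes psi. *)
Lemma range_projection_L_space z : is_central_projection z ->
  is_L_space [set wact_l z phi | phi in setT].
Proof.
move=> cz _ psi [phi _ <-] le; exists psi => //.
have := central_support_le cz (_ : wact_l z (wact_l z phi) = wact_l z phi).
rewrite -wact_lM cz.1.1 => /(_ erefl); rewrite /proj_le => le'.
have le'' : central_support psi * z = central_support psi by rewrite -le -mulrA le'.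
by rewrite -{1}(wact_l_central_support psi) -wact_lM cz.2 le'' wact_l_central_support.
Qed.

End central_support.

Theorem proposition4p18 (R : realType) (G : groupType)
    (X : set (fourier_stieltjes R G))
    (subX : is_subspace X) (closedX : closed X) :
  [<-> is_L_space X;
       is_biinvariant X;
       exists z : wstar R G, is_central_projection z /\
         X = [set wact_l z phi | phi in setT]].
Proof.
tfae.
- exact: L_space_biinvariant.
- exact: biinvariant_projection.
- by move=> [z [cz ->]]; exact: range_projection_L_space.
Qed.
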